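(* Let $a_1 a_2 \cdots$ be a sequence of non-negative integers such that $$a_k a_{k+1} \cdots \le_{\mathrm{alt}} a_1 a_2 \cdots \quad \text{for all } k \ge 2,$$ and $$a_1 a_2 \cdots >_{\mathrm{alt}} u_1 u_2 \cdots .$$ Then there exists a unique real number $\beta > 1$ such that $$- \sum_{j=1}^\infty \frac{a_j+1}{(-\beta)^j} = 1 \quad \text{and} \quad - \sum_{j=1}^\infty \frac{a_{k+j}+1}{(-\beta)^j} \in [0,1] \quad \text{for all } k \ge 1.$$ Moreover, for this $\beta$, one has $\sum_{j=1}^\infty \frac{a_{k+j}+1}{(-\beta)^j} \ne 0$ for all $k \ge 1$ if and only if both of the following conditions hold: (A) $a_1 a_2 \cdots \notin \{a_1 \cdots a_k,\ a_1 \cdots a_{k-1} (a_k-1)\, 0\}^\omega \setminus \{\overline{a_1 \cdots a_k}\}$ for all $k \ge 1$ with $\overline{a_1 \cdots a_k} >_{\mathrm{alt}} u_1 u_2 \cdots$; (B) $a_1 a_2 \cdots \notin \{a_1 \cdots a_k\, 0,\ a_1 \cdots a_{k-1} (a_k+1)\}^\omega$ for all $k \ge 1$ with $\overline{a_1 \cdots a_{k-1} (a_k+1)} >_{\mathrm{alt}} u_1 u_2 \cdots$.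
   Context: The alternating lexicographic order on infinite sequences of integers is defined as follows: if $x_1 \cdots x_{k-1} = y_1 \cdots y_{k-1}$ and $x_k \ne y_k$, then $x_1 x_2 \cdots <_{\mathrm{alt}} y_1 y_2 \cdots$ if and only if $x_k < y_k$ when $k$ is odd, and $y_k < x_k$ when $k$ is even. As usual, $\le_{\mathrm{alt}}$ means $<_{\mathrm{alt}}$ or equal, and $>_{\mathrm{alt}}$ is the reverse of $<_{\mathrm{alt}}$. Let $\varphi$ be the morphism of words on the alphabet $\{0,1\}$ (i.e. compatible with concatenation) defined by $\varphi(1) = 100$, $\varphi(0) = 1$. The sequence $u_1 u_2 \cdots = 100111001001001110011\cdots$ is the infinite sequence that starts with $\varphi^n(1)$ for all $n \ge 0$. For finite words $v, w$ of integers, $\{v, w\}^\omega$ denotes the set of all infinite sequences obtained by concatenating infinitely many blocks each equal to $v$ or $w$, and $\overline{v} = vvv\cdots$ denotes the periodic sequence with period $v$. In $a_1 \cdots a_{k-1}(a_k \pm 1)$, the last letter is the integer $a_k \pm 1$; for $k = 1$ the word $a_1\cdots a_{k-1}$ is empty. *)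

(* Defs.v *)
From Stdlib Require Import Reals Lra Lia ZArith Arith List.
From Coquelicot Require Import Coquelicot.
Import ListNotations.

(* An infinite sequence x_1 x_2 ... of integers is a function [x : nat -> Z]
   with x_j = x (j - 1): positions start at 0, so odd positions j = i + 1 are
   those with i even. *)

Definition seq_drop (k : nat) (x : nat -> Z) : nat -> Z := fun n => x (k + n)%nat.

Definition seq_take (k : nat) (x : nat -> Z) : list Z := map x (seq 0 k).

Definition starts_with (x : nat -> Z) (w : list Z) : Prop :=
  seq_take (length w) x = w.

Definition seq_eq (x y : nat -> Z) : Prop := forall n, x n = y n.

Definition lt_alt (x y : nat -> Z) : Prop :=
  exists i : nat, (forall j, (j < i)%nat -> x j = y j) /\
    (if Nat.even i then (x i < y i)%Z else (y i < x i)%Z).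

Definition le_alt (x y : nat -> Z) : Prop := lt_alt x y \/ seq_eq x y.

(* The letters 1 and 0 are [true] and [false]. *)
Definition phi_letter (c : bool) : list bool :=
  if c then [true; false; false] else [true].

Definition phi (w : list bool) : list bool := flat_map phi_letter w.

(* phi^n(1) has more than n letters and is a prefix of phi^(n+1)(1), so letter
   number n can be read off phi^n(1); see [u_starts_with]. *)
Definition u (n : nat) : Z :=
  Z.b2z (nth n (Nat.iter n phi [true]) false).

Lemma phi_iter_extend (n : nat) :
  exists w, w <> [] /\
    Nat.iter (S n) phi [true] = Nat.iter n phi [true] ++ w.
Proof.
  induction n as [|n [w [Hw IH]]].
  - now exists [false; false].
  - exists (phi w). split.
    + destruct w as [|[|] w]; [congruence | easy | easy].
    + change (phi (Nat.iter (S n) phi [true])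
              = phi (Nat.iter n phi [true]) ++ phi w).
      rewrite IH. apply flat_map_app.
Qed.

Lemma phi_iter_extend_le (m n : nat) (H : (m <= n)%nat) :
  exists w, Nat.iter n phi [true] = Nat.iter m phi [true] ++ w.
Proof.
  induction H as [|n H [w IH]].
  - exists []. now rewrite app_nil_r.
  - destruct (phi_iter_extend n) as [w' [_ E]].
    exists (w ++ w'). now rewrite E, IH, app_assoc.
Qed.

Lemma phi_iter_length (n : nat) : (n < length (Nat.iter n phi [true]))%nat.
Proof.
  induction n as [|n IH]; [simpl; lia|].
  destruct (phi_iter_extend n) as [w [Hw E]].
  rewrite E, length_app. destruct w; [congruence | simpl length; lia].
Qed.

Lemma u_starts_with (n : nat) :
  starts_with u (map Z.b2z (Nat.iter n phi [true])).
Proof.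
  unfold starts_with, seq_take. rewrite length_map.
  apply nth_ext with (d := u 0) (d' := Z.b2z false);
    rewrite !length_map, length_seq; [easy|].
  intros i Hi. rewrite !map_nth, seq_nth by easy. unfold u. f_equal.
  rewrite Nat.add_0_l. pose proof (phi_iter_length i).
  destruct (Nat.le_ge_cases i n) as [L|L];
    destruct (phi_iter_extend_le _ _ L) as [w E]; rewrite E.
  - now rewrite app_nth1.
  - now rewrite app_nth1.
Qed.

Definition periodic (v : list Z) : nat -> Z :=
  fun n => nth (n mod length v) v 0%Z.

(* x \in {v, w}^omega, for nonempty words v and w: only then do the finite
   concatenations of the blocks determine every letter of x. *)
Definition in_omega (v w : list Z) (x : nat -> Z) : Prop :=
  exists B : nat -> list Z, (forall i, B i = v \/ B i = w) /\
    forall n, starts_with x (concat (map B (seq 0 n))).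

(* sum_{j >= 1} (x_j + 1) / (-beta)^j; [Series] is total, but this is a genuine
   sum for bounded x and beta > 1, see [ex_alt_series]. *)
Definition alt_series (beta : R) (x : nat -> Z) : R :=
  Series (fun i => (IZR (x i) + 1) / (- beta) ^ (S i))%R.

Lemma ex_alt_series (beta : R) (x : nat -> Z) (M : Z) (Hb : (1 < beta)%R)
  (Hx : forall n, (0 <= x n <= M)%Z) :
  ex_series (fun i => (IZR (x i) + 1) / (- beta) ^ (S i))%R.
Proof.
  apply ex_series_Rabs.
  assert (Hi : (0 < / beta < 1)%R).
  { split; [apply Rinv_0_lt_compat; lra|].
    rewrite <- Rinv_1. apply Rinv_lt_contravar; lra. }
  apply (@ex_series_le R_AbsRing R_CompleteNormedModule) with
    (b := fun i => ((IZR M + 1) * (/ beta) ^ i)%R).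
  - intros i. change (norm ?a) with (Rabs a). rewrite Rabs_Rabsolu.
    destruct (Hx i) as [H0 HM]. apply IZR_le in H0, HM.
    unfold Rdiv. rewrite Rabs_mult, Rabs_inv, <- RPow_abs, Rabs_Ropp.
    rewrite (Rabs_pos_eq beta), Rabs_pos_eq, <- pow_inv by lra.
    assert (Hp : (0 < (/ beta) ^ i)%R) by (apply pow_lt; lra).
    simpl. apply Rmult_le_compat; [lra | nra | lra | nra].
  - apply (@ex_series_scal R_AbsRing R_NormedModule (IZR M + 1)%R).
    apply ex_series_geom. rewrite Rabs_pos_eq; lra.
Qed.

(* Main.v *)
Require Import Defs.
From Stdlib Require Import Reals ZArith List.
From Stdlib Require Import Lra Lia Psatz Arith Classical ClassicalEpsilon Wf_nat.
From Coquelicot Require Import Coquelicot.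
Import ListNotations.
Open Scope R_scope.

(** Put [t k = - alt_series beta (seq_drop k a)]. The three conditions on [beta]
    say that [t 0 = 1], that [t (k + 1) = a_(k+1) + 1 - beta * t k], and that
    this orbit stays in [0, 1] ([expands_one]). So [a] is an itinerary of 1 for a
    map with slope [- beta], and [beta] is found, and shown to be unique, from
    the combinatorics of [a].

    Existence is a counting argument. Let [nwords a n 0] be the number of words
    of length [n] whose suffixes are all at most [a]. It is submultiplicative;
    let [lam] be its exponential growth rate. For [beta > lam] the generating
    functions of words below [seq_drop k a], divided by the generating function
    of all words, give an orbit with [0 <= t k <= t 0 < 1]; when [beta] decreases
    to [lam > 1], the value [t 0] tends to 1 because the generating function of
    all words diverges at [1 / lam], and the limit orbit expands 1
    ([expansion_dichotomy]). If [lam = 1], such orbits exist for all [beta > 1],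
    and renormalization excludes this for [a] above [u].

    Renormalization: if [beta] is small enough, an orbit starting close to 1
    reads only the blocks 100 and 1, and the induced map on the beginnings of the
    blocks is again piecewise affine, with one slope for each of the two letters
    ([skew_desubst], [level_orbit_desubst]). The slopes at level [n] are
    [- beta ^ h] and [- beta ^ g], where [h] and [g] are the lengths of
    [phi^n(0)] and [phi^n(1)]. A sequence above [u] can only be desubstituted
    finitely often, because this moves the first difference with [u] to the left,
    but near [beta = 1] it could be done arbitrarily often
    ([level_orbit_gt_u_absurd], [expansion_exists]).

    Uniqueness ([expands_one_unique]) compares orbits [y], [z] of the same
    sequence in two bases [beta < eta]. If [eta] exceeds the golden mean, the
    slope is large enough to make the difference of the orbits grow
    exponentially. Otherwise both are desubstituted as long as [beta] forces the
    blocks 100 and 1, which ends since [beta ^ h < beta + 1] is needed at every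
    level. At the last level either the first run of letters 0 is odd or infinite,
    and the slopes are large ([pair_odd_run]), or all runs of letters 0 are even,
    and the difference is followed from one letter 1 to the next but one
    ([pair_even_run]). In both cases it grows without bound.

    For the conditions (A) and (B), note that [t k = 0] forces the digit 0 and
    [t (k + 1) = 1]. Let [k] be the first positive time at which the orbit of 1
    meets 0 or 1. Until then the digits are the only possible ones, and at time
    [k] two digits are possible, one leading to 1 and the other to 0, hence to 1
    one step later. Thus [a] is a concatenation of two words, those of (A) if
    [t k = 1] and those of (B) if [t k = 0] ([words_of_zero]), and the periodic
    word of the pair is above [u], as is every expansion of 1
    ([expands_one_gt_u]). Conversely, if [a] is a concatenation of such words, the
    periodic sequence is admissible, the base attached to it also expands 1 into
    [a], so that it is [beta] by uniqueness, and the second word makes the orbit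
    pass through 0 ([coded_zero]). *)

(** * The alternating order and orbits *)

Definition first_diff (i : nat) (x y : nat -> Z) : Prop :=
  (forall j, (j < i)%nat -> x j = y j) /\
  (if Nat.even i then (x i < y i)%Z else (y i < x i)%Z).

Lemma even_S_negb n : Nat.even (S n) = negb (Nat.even n).
Proof. rewrite Nat.even_succ. symmetry. apply Nat.negb_even. Qed.

Lemma first_diff_S i x y :
  first_diff (S i) x y <->
  x 0%nat = y 0%nat /\ first_diff i (seq_drop 1 y) (seq_drop 1 x).
Proof.
  unfold first_diff, seq_drop. rewrite even_S_negb. split.
  - intros [H1 H2]. split; [apply H1; lia|]. split.
    + intros j Hj. symmetry. apply H1. lia.
    + simpl Nat.add. destruct (Nat.even i); simpl in H2; exact H2.
  - intros [H0 [H1 H2]]. split.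
    + intros [|j] Hj; [easy|]. symmetry. apply (H1 j). lia.
    + simpl Nat.add in H2. destruct (Nat.even i); simpl; exact H2.
Qed.

Lemma exists_least (P : nat -> Prop) :
  (exists n, P n) -> exists n, P n /\ forall m, (m < n)%nat -> ~ P m.
Proof.
  intros H. destruct (dec_inh_nat_subset_has_unique_least_element P
    (fun n => classic (P n)) H) as [n [[Hn Hm] _]].
  exists n. split; [easy|]. intros m L Pm. specialize (Hm m Pm). lia.
Qed.

Lemma first_diff_exists x y :
  ~ seq_eq x y -> exists i, first_diff i x y \/ first_diff i y x.
Proof.
  intros H. destruct (exists_least (fun n => x n <> y n)) as [i [Hi Hl]].
  { apply not_all_ex_not. exact H. }
  exists i. unfold first_diff.
  assert (E : forall j, (j < i)%nat -> x j = y j).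
  { intros j Hj. apply NNPP. exact (Hl j Hj). }
  destruct (Nat.even i), (Z.lt_total (x i) (y i)) as [L|[L|L]]; try easy;
    try (left; now split); right; split; trivial;
    intros; symmetry; auto.
Qed.

Lemma alt_total x y : lt_alt x y \/ seq_eq x y \/ lt_alt y x.
Proof.
  destruct (classic (seq_eq x y)) as [E|E]; [tauto|].
  destruct (first_diff_exists x y E) as [i [H|H]]; [left|do 2 right]; now exists i.
Qed.

Lemma first_diff_asym i j x y : first_diff i x y -> first_diff j y x -> False.
Proof.
  intros [H1 H2] [H3 H4]. destruct (lt_eq_lt_dec i j) as [[L|L]|L].
  - specialize (H3 i L). destruct (Nat.even i); lia.
  - subst. destruct (Nat.even j); lia.
  - specialize (H1 j L). destruct (Nat.even j); lia.
Qed.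

Lemma lt_alt_not_le x y : lt_alt x y -> ~ le_alt y x.
Proof.
  intros [i H] [[j H']|E].
  - exact (first_diff_asym _ _ _ _ H H').
  - destruct H as [_ H]. specialize (E i). destruct (Nat.even i); lia.
Qed.

Lemma not_lt_alt_le x y : ~ lt_alt x y -> le_alt y x.
Proof.
  intros H. destruct (alt_total x y) as [L|[E|L]]; [easy| |now left].
  right. intros n. symmetry. apply E.
Qed.

Lemma le_alt_refl x : le_alt x x.
Proof. now right. Qed.

Lemma le_alt_head x y : le_alt x y -> (x 0%nat <= y 0%nat)%Z.
Proof.
  intros [[[|i] [H1 H2]]|H].
  - simpl in H2. lia.
  - rewrite (H1 0%nat); lia.
  - rewrite (H 0%nat). lia.
Qed.

(** Removing an equal first letter swaps the parities of all positions. *)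
Lemma le_alt_tail x y :
  x 0%nat = y 0%nat -> le_alt x y -> le_alt (seq_drop 1 y) (seq_drop 1 x).
Proof.
  intros E [[[|i] H]|H].
  - destruct H as [_ H]. simpl in H. lia.
  - left. exists i. now apply first_diff_S in H.
  - right. intros n. symmetry. apply H.
Qed.

Lemma le_alt_ext x y x' y' :
  seq_eq x x' -> seq_eq y y' -> le_alt x y -> le_alt x' y'.
Proof.
  intros Ex Ey [[i [H1 H2]]|H].
  - left. exists i. split.
    + intros j Hj. rewrite <- Ex, <- Ey. now apply H1.
    + rewrite <- Ex, <- Ey. exact H2.
  - right. intros n. rewrite <- Ex, <- Ey. apply H.
Qed.

Lemma lt_alt_ext x y x' y' :
  seq_eq x x' -> seq_eq y y' -> lt_alt x y -> lt_alt x' y'.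
Proof.
  intros Ex Ey [i [H1 H2]]. exists i. split.
  - intros j Hj. rewrite <- Ex, <- Ey. now apply H1.
  - rewrite <- Ex, <- Ey. exact H2.
Qed.

Lemma le_alt_drop j x y :
  (forall m, (m < j)%nat -> x m = y m) -> le_alt x y ->
  if Nat.even j then le_alt (seq_drop j x) (seq_drop j y)
  else le_alt (seq_drop j y) (seq_drop j x).
Proof.
  revert x y. induction j as [|j IH]; intros x y E H; [exact H|].
  rewrite even_S_negb.
  assert (H1 := le_alt_tail x y (E 0%nat ltac:(lia)) H).
  specialize (IH (seq_drop 1 y) (seq_drop 1 x)).
  assert (E' : forall m, (m < j)%nat -> seq_drop 1 y m = seq_drop 1 x m).
  { intros m Hm. symmetry. apply (E (S m)). lia. }
  specialize (IH E' H1). destruct (Nat.even j); exact IH.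
Qed.

Lemma lt_alt_drop_inv j x y :
  (forall m, (m < j)%nat -> x m = y m) ->
  (if Nat.even j then lt_alt (seq_drop j x) (seq_drop j y)
  else lt_alt (seq_drop j y) (seq_drop j x)) -> lt_alt x y.
Proof.
  intros E H.
  assert (~ le_alt y x); [|destruct (alt_total x y) as [L|[L|L]]].
  - intros L. assert (L' := le_alt_drop j y x (fun m Hm => eq_sym (E m Hm)) L).
    destruct (Nat.even j); exact (lt_alt_not_le _ _ H L').
  - exact L.
  - destruct H0. right. intros n. symmetry. apply L.
  - destruct H0. now left.
Qed.

(** The order is decided at the first difference, which cannot lie inside the
    common prefix. *)
Lemma le_alt_squeeze n x y z :
  le_alt x y -> le_alt y z -> (forall m, (m < n)%nat -> x m = z m) ->
  forall m, (m < n)%nat -> y m = z m.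
Proof.
  revert x y z. induction n as [|n IH]; intros x y z H1 H2 E m Hm; [lia|].
  assert (E0 : y 0%nat = z 0%nat).
  { apply le_alt_head in H1, H2. rewrite (E 0%nat) in H1; lia. }
  destruct m as [|m]; [easy|].
  assert (Ex : x 0%nat = y 0%nat) by (rewrite E0; apply E; lia).
  symmetry in E0 |- *.
  apply le_alt_tail in H1; [|easy]. apply le_alt_tail in H2; [|easy].
  transitivity (x (S m)); [symmetry; apply E; lia|]. symmetry.
  apply (IH _ _ _ H2 H1); [|lia].
  intros i Hi. symmetry. apply (E (S i)). lia.
Qed.

Definition admissible (a : nat -> Z) : Prop := forall k, le_alt (seq_drop k a) a.

Definition orbit (beta : R) (x : nat -> Z) (t : nat -> R) : Prop :=
  forall k, t (S k) = IZR (x k) + 1 - beta * t k.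

Definition expands_one (beta : R) (x : nat -> Z) (t : nat -> R) : Prop :=
  orbit beta x t /\ t 0%nat = 1 /\ forall k, 0 <= t k <= 1.

Lemma orbit_drop beta x t k :
  orbit beta x t -> orbit beta (seq_drop k x) (fun n => t (k + n)%nat).
Proof. intros H n. rewrite Nat.add_succ_r. apply H. Qed.

(** Used to contradict boundedness of quantities that grow by a factor [c] in
    each step. *)
Lemma pow_unbounded (c K d : R) : 1 < c -> 0 < d -> exists n, K < c ^ n * d.
Proof.
  intros Hc Hd. destruct (Pow_x_infinity c) with (b := K / d + 1) as [n Hn].
  { rewrite Rabs_pos_eq; lra. }
  exists n. specialize (Hn n (le_n n)).
  rewrite Rabs_pos_eq in Hn by (apply pow_le; lra).
  apply Rmult_lt_reg_r with (/ d); [now apply Rinv_0_lt_compat|].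
  rewrite Rmult_assoc, Rinv_r by lra. unfold Rdiv in Hn. lra.
Qed.

(** The partial sums telescope, up to [t (S n) / (- beta) ^ (S n)]. *)
Lemma orbit_series beta x t :
  1 < beta -> orbit beta x t -> (forall k, 0 <= t k <= 1) ->
  alt_series beta x = - t 0%nat.
Proof.
  intros Hb Ho Ht. apply is_series_unique.
  assert (Hs : forall n, sum_n (fun i => (IZR (x i) + 1) / (- beta) ^ S i) n
    = t (S n) * (/ - beta) ^ S n + - t 0%nat).
  { intros n. assert (Hnb : - beta <> 0) by lra.
    assert (Hp : forall m, (- beta) ^ m <> 0) by (intros; now apply pow_nonzero).
    induction n as [|n IH].
    - rewrite sum_O, Ho. simpl. field. lra.
    - rewrite sum_Sn, IH. change (plus ?u ?v) with (u + v). rewrite (Ho (S n)).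
      rewrite !pow_inv. assert (P := Hp n). simpl. field. repeat split; auto; lra. }
  apply (is_lim_seq_ext (fun n => t (S n) * (/ - beta) ^ S n + - t 0%nat)
    _ (Finite (- t 0%nat))); [intros; symmetry; apply Hs|].
  replace (Finite (- t 0%nat)) with (Finite (0 + - t 0%nat)) by (f_equal; lra).
  apply is_lim_seq_plus'; [|apply is_lim_seq_const].
  apply is_lim_seq_abs_0.
  assert (Hi : 0 < / beta < 1).
  { split; [apply Rinv_0_lt_compat; lra|].
    rewrite <- Rinv_1. apply Rinv_lt_contravar; lra. }
  apply is_lim_seq_le_le with (fun _ => 0) (fun n => (/ beta) ^ S n).
  - intros n. split; [apply Rabs_pos|].
    rewrite Rabs_mult, <- RPow_abs, Rabs_inv, Rabs_Ropp, (Rabs_pos_eq beta) by lra.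
    rewrite Rabs_pos_eq by apply Ht.
    assert (0 < (/ beta) ^ S n) by (apply pow_lt; lra).
    specialize (Ht (S n)). nra.
  - apply is_lim_seq_const.
  - apply (is_lim_seq_incr_1 (fun n => (/ beta) ^ n)). apply is_lim_seq_geom. rewrite Rabs_pos_eq; lra.
Qed.

(** Converse of [orbit_series]: splitting off the first term gives the recursion,
    which needs convergence, hence the bound [M]. *)
Lemma series_orbit beta x M :
  1 < beta -> (forall n, (0 <= x n <= M)%Z) ->
  orbit beta x (fun k => - alt_series beta (seq_drop k x)).
Proof.
  intros Hb Hx k. unfold alt_series at 2. rewrite Series_incr_1.
  2: { apply ex_alt_series with M; [easy|]. intros n. apply Hx. }
  rewrite (Series_ext _ (fun i => / - beta *
    ((IZR (seq_drop (S k) x i) + 1) / (- beta) ^ S i))).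
  - rewrite Series_scal_l. unfold seq_drop at 2. rewrite Nat.add_0_r.
    fold (alt_series beta (seq_drop (S k) x)). simpl. field. lra.
  - intros n. unfold seq_drop. rewrite <- Nat.add_succ_comm.
    assert (P : (- beta) ^ n <> 0) by (apply pow_nonzero; lra).
    simpl. field. split; [easy|lra].
Qed.

(** Each letter reverses the order of the rest, so that the value of the orbit
    at 0 follows the alternating order. *)
Lemma orbit_monotone beta x y t t' :
  1 < beta -> orbit beta x t -> orbit beta y t' ->
  (forall k, 0 <= t k <= 1) -> (forall k, 0 <= t' k <= 1) ->
  lt_alt x y -> t 0%nat <= t' 0%nat.
Proof.
  intros Hb Ho Ho' Ht Ht' [i Hi]. revert x y t t' Ho Ho' Ht Ht' Hi.
  induction i as [|i IH]; intros x y t t' Ho Ho' Ht Ht' Hi.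
  - destruct Hi as [_ Hi]. simpl in Hi.
    assert (L : (x 0%nat + 1 <= y 0%nat)%Z) by lia. apply IZR_le in L.
    rewrite plus_IZR in L. assert (E := Ho 0%nat). assert (E' := Ho' 0%nat).
    specialize (Ht 1%nat). specialize (Ht' 1%nat). nra.
  - apply first_diff_S in Hi. destruct Hi as [E Hi].
    assert (L : t' 1%nat <= t 1%nat).
    { apply (IH _ _ _ _ (orbit_drop beta y t' 1 Ho') (orbit_drop beta x t 1 Ho)); auto. }
    rewrite Ho, Ho', E in L. nra.
Qed.

(** * Existence by counting words *)

(** The number of words [w] of length [n] such that all suffixes of [w] are at
    most [a], and [w] is at most [seq_drop k a], comparing only the first letters:
    a word [d w'] is counted if [d < a k], or if [d = a k] and [w'] is at least
    [seq_drop (S k) a]. The latter words are all words, without those below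
    [seq_drop (S k) a], plus one for the prefix of that sequence. *)
Fixpoint nwords (a : nat -> Z) (n k : nat) : R :=
  match n with
  | O => 1
  | S n => (IZR (a k) + 1) * nwords a n 0 - nwords a n (S k) + 1
  end.

Section Counting.
Variable a : nat -> Z.
Hypothesis a_nonneg : forall n, (0 <= a n)%Z.
Hypothesis a_adm : admissible a.

(** The first part says that the prefix of [seq_drop k a] is counted. Both parts
    are proved together, since the recursion subtracts. *)
Lemma nwords_order n :
  (forall k, 1 <= nwords a n k) /\
  (forall k l, le_alt (seq_drop k a) (seq_drop l a) -> nwords a n k <= nwords a n l).
Proof.
  induction n as [|n [IH1 IH2]]; [split; intros; simpl; lra|].
  assert (top : forall k, nwords a n k <= nwords a n 0).
  { intros k. apply IH2. apply a_adm. }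
  split.
  - intros k. simpl. assert (H := IZR_le _ _ (a_nonneg k)).
    specialize (top (S k)). specialize (IH1 0%nat). nra.
  - intros k l H. simpl. assert (L := le_alt_head _ _ H).
    unfold seq_drop in L. rewrite !Nat.add_0_r in L.
    apply Zle_lt_or_eq in L. destruct L as [L|L].
    + assert (L' : (a k + 1 <= a l)%Z) by lia. apply IZR_le in L'.
      rewrite plus_IZR in L'. assert (A := top (S l)). assert (B := IH1 (S k)).
      assert (C := IH1 0%nat). nra.
    + assert (T : nwords a n (S l) <= nwords a n (S k)).
      { apply IH2. apply (le_alt_ext (seq_drop 1 (seq_drop l a)) (seq_drop 1 (seq_drop k a))).
        - intros m. unfold seq_drop. f_equal. lia.
        - intros m. unfold seq_drop. f_equal. lia.
        - apply le_alt_tail; [|exact H]. unfold seq_drop. now rewrite !Nat.add_0_r. }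
      rewrite L. lra.
Qed.

Lemma nwords_ge_1 n k : 1 <= nwords a n k.
Proof. apply nwords_order. Qed.

Lemma nwords_le n k : nwords a n k <= nwords a n 0.
Proof. apply nwords_order. apply a_adm. Qed.

(** A word of length [n + m] is made of two words of lengths [n] and [m]. The
    second part, for the words between two shifts of [a], is what the subtracted
    term of the recursion inherits. *)
Lemma nwords_submult_aux m n :
  (forall k, nwords a (n + m) k <= nwords a n k * nwords a m 0) /\
  (forall k l, le_alt (seq_drop k a) (seq_drop l a) ->
    nwords a (n + m) l - nwords a (n + m) k + 1
    <= (nwords a n l - nwords a n k + 1) * nwords a m 0).
Proof.
  induction n as [|n [IH1 IH2]].
  - simpl. split; intros k; [|intros l _].
    + assert (H := nwords_le m k). lra.
    + assert (H := nwords_le m l). assert (H' := nwords_ge_1 m k). lra.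
  - assert (top : forall k, le_alt (seq_drop k a) (seq_drop 0 a)).
    { intros k. apply a_adm. }
    split; intros k; [|intros l H]; simpl.
    + assert (A := IH2 _ _ (top (S k))). assert (B := IH1 0%nat).
      assert (H := IZR_le _ _ (a_nonneg k)).
      assert (C := Rmult_le_compat_l _ _ _ H B). lra.
    + assert (L := le_alt_head _ _ H).
      unfold seq_drop in L. rewrite !Nat.add_0_r in L.
      apply Zle_lt_or_eq in L. destruct L as [L|L].
      * assert (L' : (a k + 1 <= a l)%Z) by lia. apply IZR_le in L'.
        rewrite plus_IZR in L'. assert (A := IH2 _ _ (top (S l))).
        assert (B := IH1 (S k)). assert (B0 := IH1 0%nat).
        assert (C := Rmult_le_compat_l (IZR (a l) - IZR (a k) - 1) _ _ ltac:(lra) B0). lra.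
      * assert (T := IH2 (S l) (S k)). rewrite L.
        enough (le_alt (seq_drop (S l) a) (seq_drop (S k) a)) by (specialize (T H0); lra).
        apply (le_alt_ext (seq_drop 1 (seq_drop l a)) (seq_drop 1 (seq_drop k a))).
        -- intros i. unfold seq_drop. f_equal. lia.
        -- intros i. unfold seq_drop. f_equal. lia.
        -- apply le_alt_tail; [|exact H]. unfold seq_drop. now rewrite !Nat.add_0_r.
Qed.

Lemma nwords_submult n m : nwords a (n + m) 0 <= nwords a n 0 * nwords a m 0.
Proof. apply nwords_submult_aux. Qed.

Lemma ex_series_bounded (u : nat -> R) (K : R) :
  (forall n, 0 <= u n) -> (forall n, sum_n u n <= K) -> ex_series u.
Proof.
  intros H0 HK. destruct (ex_finite_lim_seq_incr (sum_n u) K) as [l Hl]; trivial.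
  - intros n. rewrite sum_Sn. change (plus ?x ?y) with (x + y).
    specialize (H0 (S n)). lra.
  - exists l. exact Hl.
Qed.

Lemma sum_n_split (u : nat -> R) m n :
  sum_n u (S m + n) = sum_n u m + sum_n (fun i => u (S m + i)%nat) n.
Proof.
  induction n as [|n IH].
  - rewrite Nat.add_0_r, sum_Sn, sum_O, Nat.add_0_r. reflexivity.
  - rewrite Nat.add_succ_r, !sum_Sn, IH. change (plus ?x ?y) with (x + y).
    rewrite Nat.add_succ_r. lra.
Qed.

Lemma sum_n_mono (u : nat -> R) m n :
  (forall n, 0 <= u n) -> (m <= n)%nat -> sum_n u m <= sum_n u n.
Proof.
  intros H0 H. induction H as [|n _ IH]; [lra|].
  rewrite sum_Sn. change (plus ?x ?y) with (x + y). specialize (H0 (S n)). lra.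
Qed.

(** If the [m]-th term is below 1, submultiplicativity bounds the partial sums by
    those of a contraction: [S <= A + u m * S]. *)
Lemma nwords_series beta m :
  0 < beta -> (1 <= m)%nat -> nwords a m 0 < beta ^ m ->
  ex_series (fun n => nwords a n 0 * (/ beta) ^ n).
Proof.
  intros Hb Hm HN. set (u := fun n => nwords a n 0 * (/ beta) ^ n).
  assert (Hi : 0 < / beta) by now apply Rinv_0_lt_compat.
  assert (Hu : forall n, 0 < u n).
  { intros n. apply Rmult_lt_0_compat; [|now apply pow_lt].
    assert (H := nwords_ge_1 n 0). lra. }
  assert (Hc : u m < 1).
  { unfold u. rewrite pow_inv. apply Rmult_lt_reg_r with (beta ^ m); [now apply pow_lt|].
    assert (beta ^ m <> 0) by (apply pow_nonzero; lra).
    rewrite Rmult_assoc, Rinv_l by easy. lra. }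
  destruct m as [|m]; [lia|].
  assert (Hs : forall n, u (S m + n)%nat <= u (S m) * u n).
  { intros n. unfold u. rewrite pow_add. assert (H := nwords_submult (S m) n).
    assert (P := pow_lt _ (S m + n) Hi). rewrite pow_add in P. nra. }
  apply ex_series_bounded with (sum_n u m / (1 - u (S m))); [intros; apply Rlt_le, Hu|].
  intros n.
  assert (A : sum_n u n <= sum_n u m + u (S m) * sum_n u n).
  { apply Rle_trans with (sum_n u (S m + n)).
    - apply sum_n_mono; [intros; apply Rlt_le, Hu|lia].
    - rewrite sum_n_split. apply Rplus_le_compat_l.
      rewrite <- (sum_n_mult_l (K := R_AbsRing)). apply sum_n_m_le. exact Hs. }
  apply Rmult_le_reg_r with (1 - u (S m)); [lra|].
  unfold Rdiv. rewrite Rmult_assoc, Rinv_l by lra. lra.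
Qed.

(** With [F k] the generating function of [nwords a _ k] at [z = 1 / beta], the
    recursion for [nwords] says that [t k = (F k - d) / F 0] is an orbit, where
    [d = 1 / (1 - z ^ 2)] absorbs the constant terms. Then [t 0 = 1 - d / F 0] is
    close to 1 if [F 0], which is at least [1 / (1 - lam / beta)], is large. *)
Lemma subcritical_orbit beta m lam :
  1 < beta -> (1 <= m)%nat -> nwords a m 0 < beta ^ m ->
  0 <= lam < beta -> (forall n, lam ^ n <= nwords a n 0) ->
  exists t, orbit beta a t /\ (forall k, 0 <= t k <= t 0%nat) /\ t 0%nat < 1 /\
    1 - t 0%nat <= (1 - lam / beta) / (1 - / beta * / beta).
Proof.
  intros Hb Hm HN Hl HlN. set (z := / beta).
  assert (Hz : 0 < z < 1).
  { unfold z. split; [apply Rinv_0_lt_compat; lra|].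
    rewrite <- Rinv_1. apply Rinv_lt_contravar; lra. }
  assert (Hbz : beta * z = 1) by (unfold z; field; lra).
  assert (Hzn : forall n, 0 < z ^ n) by (intros; apply pow_lt; lra).
  assert (E0 := nwords_series beta m ltac:(lra) Hm HN). fold z in E0.
  assert (E : forall k, ex_series (fun n => nwords a n k * z ^ n)).
  { intros k. apply (ex_series_le (K := R_AbsRing) (V := R_CompleteNormedModule) _
      (fun n => nwords a n 0 * z ^ n)); [|exact E0].
    intros n. change (norm ?x) with (Rabs x).
    assert (A := nwords_ge_1 n k). assert (B := nwords_le n k). specialize (Hzn n).
    rewrite Rabs_pos_eq by nra. nra. }
  set (F := fun k => Series (fun n => nwords a n k * z ^ n)).
  assert (F_le : forall k, F k <= F 0%nat).
  { intros k. apply Series_le; [|exact E0]. intros n.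
    assert (A := nwords_ge_1 n k). assert (B := nwords_le n k). specialize (Hzn n). nra. }
  assert (F_geom : forall q, 0 <= q < 1 -> (forall n, q ^ n <= nwords a n 0 * z ^ n) ->
    / (1 - q) <= F 0%nat).
  { intros q Hq Hn. rewrite <- Series_geom by (rewrite Rabs_pos_eq; lra).
    apply Series_le; [|exact E0]. intros n. split; [apply pow_le; lra|apply Hn]. }
  assert (G1 : ex_series (fun n => z ^ n)) by (apply ex_series_geom; rewrite Rabs_pos_eq; lra).
  assert (F_rec : forall k,
    F k = 1 + z * ((IZR (a k) + 1) * F 0%nat - F (S k) + / (1 - z))).
  { intros k. unfold F at 1. rewrite Series_incr_1 by apply E. simpl (nwords a 0 k * z ^ 0).
    f_equal; [ring|]. rewrite <- Series_geom by (rewrite Rabs_pos_eq; lra).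
    unfold F. rewrite <- Series_scal_l.
    assert (E1 : ex_series (fun n => (IZR (a k) + 1) * (nwords a n 0 * z ^ n)))
      by exact (ex_series_scal (K := R_AbsRing) (V := R_NormedModule) _ _ (E 0%nat)).
    rewrite <- Series_minus; [|exact E1|apply E].
    rewrite <- Series_plus; [|exact (ex_series_minus (V := R_NormedModule) _ _ E1 (E (S k)))|exact G1].
    rewrite <- Series_scal_l. apply Series_ext. intros n. simpl. ring. }
  assert (Hpos : 0 < 1 - z * z) by nra.
  set (d := / (1 - z * z)).
  assert (Hd : d * (1 - z * z) = 1) by (unfold d; field; lra).
  assert (Hd0 : 0 < d) by (apply Rinv_0_lt_compat; lra).
  assert (F0pos : / (1 - z) <= F 0%nat).
  { apply F_geom; [lra|]. intros n. assert (A := nwords_ge_1 n 0). specialize (Hzn n). nra. }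
  assert (Hlz : 0 <= lam * z < 1) by nra.
  assert (F0lam : / (1 - lam * z) <= F 0%nat).
  { apply F_geom; [easy|]. intros n. rewrite Rpow_mult_distr.
    specialize (HlN n). specialize (Hzn n). nra. }
  assert (F0 : 0 < F 0%nat).
  { apply Rlt_le_trans with (2 := F0pos). apply Rinv_0_lt_compat. lra. }
  set (t := fun k => (F k - d) / F 0%nat).
  assert (Ht0 : t 0%nat = 1 - d / F 0%nat) by (unfold t; field; lra).
  assert (Hdl : 0 < d / F 0%nat) by (apply Rdiv_lt_0_compat; lra).
  assert (Ho : orbit beta a t).
  { intros k. unfold t. rewrite (F_rec k).
    assert (H1 : / (1 - z) = d * (1 + z)).
    { unfold d. field. split; nra. }
    rewrite H1. replace beta with (/ z) by (unfold z; field; lra).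
    apply (Rmult_eq_reg_l (z * F 0%nat)); [|nra].
    transitivity (z * (F (S k) - d)); [field; lra|].
    transitivity (z * (IZR (a k) + 1) * F 0%nat - (1 + z * ((IZR (a k) + 1) * F 0%nat - F (S k) + d * (1 + z)) - d)); [|field; lra].
    nra. }
  assert (Hle : forall k, t k <= t 0%nat).
  { intros k. unfold t, Rdiv. apply Rmult_le_compat_r; [|specialize (F_le k); lra].
    apply Rlt_le, Rinv_0_lt_compat, F0. }
  exists t. repeat split; trivial.
  - assert (A := Ho k). assert (B := Hle (S k)). assert (C := IZR_le _ _ (a_nonneg k)).
    nra.
  - lra.
  - rewrite Ht0. replace (1 - (1 - d / F 0%nat)) with (d * / F 0%nat) by (unfold Rdiv; ring).
    fold z. fold d. unfold Rdiv. fold z. fold d. rewrite (Rmult_comm d).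
    apply Rmult_le_compat_r; [lra|].
    rewrite <- (Rinv_inv (1 - lam * z)). apply Rinv_le_contravar; [|exact F0lam].
    apply Rinv_0_lt_compat. lra.
Qed.

(** The set of [x] with [x ^ n <= nwords a n 0] for all [n] is closed, so that its
    supremum [lam] belongs to it. *)
Lemma growth_rate :
  exists lam, 1 <= lam /\ (forall n, lam ^ n <= nwords a n 0) /\
    forall beta, lam < beta -> exists m, (1 <= m)%nat /\ nwords a m 0 < beta ^ m.
Proof.
  set (P := fun x => 0 <= x /\ forall n, x ^ n <= nwords a n 0).
  destruct (completeness P) as [lam [Hub Hlub]].
  - exists (nwords a 1 0). intros x [_ Hx]. specialize (Hx 1%nat). lra.
  - exists 1. split; [lra|]. intros n. rewrite pow1. apply nwords_ge_1.
  - assert (H1 : 1 <= lam).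
    { apply Hub. split; [lra|]. intros n. rewrite pow1. apply nwords_ge_1. }
    exists lam. split; [easy|]. split.
    + intros n. apply Rnot_lt_le. intros Hn.
      assert (C : continuous (fun x => x ^ n) lam).
      { apply (ex_derive_continuous (V := R_NormedModule)). auto_derive. easy. }
      assert (HE : locally (lam ^ n) (fun y => nwords a n 0 < y)) by now apply open_gt.
      destruct (C _ HE) as [eps He].
      assert (Hx : nwords a n 0 < (Rmax 0 (lam - eps / 2)) ^ n).
      { apply He. destruct eps as [e Hep]. change (Rabs (Rmax 0 (lam - e / 2) - lam) < e).
        unfold Rmax. destruct (Rle_dec 0 (lam - e / 2)); rewrite Rabs_left; lra. }
      assert (L : lam <= Rmax 0 (lam - eps / 2)).
      { apply Hlub. intros x [Hx0 Hxn]. apply Rnot_lt_le. intros Hlt.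
        specialize (Hxn n).
        assert ((Rmax 0 (lam - eps / 2)) ^ n <= x ^ n); [|lra].
        apply pow_incr. split; [apply Rmax_l|lra]. }
      destruct eps as [e Hep]. simpl in L. unfold Rmax in L.
      destruct (Rle_dec 0 (lam - e / 2)); lra.
    + intros beta Hb. apply NNPP. intros Hn.
      assert (beta <= lam); [|lra]. apply Hub. split; [lra|]. intros n.
      apply Rnot_lt_le. intros L. destruct n as [|n]; [simpl in L; lra|].
      apply Hn. exists (S n). split; [lia|easy].
Qed.

(** Each [t n k] is a polynomial in [b n] and [t n 0], so it converges. *)
Lemma limit_orbit (b : nat -> R) (lam : R) (t : nat -> nat -> R) :
  is_lim_seq b lam -> (forall n, orbit (b n) a (t n)) ->
  (forall n k, 0 <= t n k <= 1) -> is_lim_seq (fun n => t n 0%nat) 1 ->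
  exists s, expands_one lam a s.
Proof.
  intros Hb Ho Ht H0.
  set (s := fix s k := match k with O => 1 | S k => IZR (a k) + 1 - lam * s k end).
  assert (L : forall k, is_lim_seq (fun n => t n k) (s k)).
  { induction k as [|k IH]; [exact H0|].
    apply (is_lim_seq_ext (fun n => IZR (a k) + 1 - b n * t n k)).
    - intros n. symmetry. apply Ho.
    - apply is_lim_seq_minus'; [apply is_lim_seq_const|].
      apply is_lim_seq_mult'; [exact Hb|exact IH]. }
  exists s. split; [now intros k|]. split; [easy|]. intros k. split.
  - apply (is_lim_seq_le (fun _ => 0) (fun n => t n k) 0 (s k));
      [intros n; apply Ht|apply is_lim_seq_const|apply L].
  - apply (is_lim_seq_le (fun n => t n k) (fun _ => 1) (s k) 1);
      [intros n; apply Ht|apply L|apply is_lim_seq_const].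
Qed.

(** The two cases are exponential and subexponential growth of [nwords a n 0]. *)
Lemma expansion_dichotomy :
  (exists beta s, 1 < beta /\ expands_one beta a s) \/
  (forall beta, 1 < beta -> exists t, orbit beta a t /\
    (forall k, 0 <= t k <= t 0%nat) /\ t 0%nat < 1).
Proof.
  destruct growth_rate as [lam [H1 [Hn Hm]]].
  destruct (Rle_lt_or_eq_dec _ _ H1) as [L|L].
  - left. exists lam. set (b := fun n => lam + / (INR n + 1)).
    assert (Hb : forall n, lam < b n).
    { intros n. unfold b. assert (0 < / (INR n + 1)); [|lra].
      apply Rinv_0_lt_compat. assert (H := pos_INR n). lra. }
    assert (Hx : forall n, exists t, orbit (b n) a t /\ (forall k, 0 <= t k <= t 0%nat) /\
       t 0%nat < 1 /\ 1 - t 0%nat <= (1 - lam / b n) / (1 - / b n * / b n)).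
    { intros n. destruct (Hm (b n) (Hb n)) as [m [Hm1 Hm2]].
      specialize (Hb n). apply subcritical_orbit with m; trivial; lra. }
    set (t := fun n => proj1_sig (constructive_indefinite_description _ (Hx n))).
    assert (Ht := fun n => proj2_sig (constructive_indefinite_description _ (Hx n))).
    change (forall n, orbit (b n) a (t n) /\ (forall k, 0 <= t n k <= t n 0%nat) /\
      t n 0%nat < 1 /\ 1 - t n 0%nat <= (1 - lam / b n) / (1 - / b n * / b n)) in Ht.
    clearbody t.
    assert (Lb : is_lim_seq b lam).
    { replace (Finite lam) with (Finite (lam + 0)) by (f_equal; lra).
      apply is_lim_seq_plus'; [apply is_lim_seq_const|].
      apply (is_lim_seq_ext (fun n => / INR (S n))).
      { intros n. now rewrite S_INR. }
      apply (is_lim_seq_incr_1 (fun n => / INR n)).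
      replace (Finite 0) with (Rbar_inv p_infty) by reflexivity.
      apply is_lim_seq_inv; [apply is_lim_seq_INR|easy]. }
    destruct (limit_orbit b lam t Lb) as [s Hs].
    + intros n. apply Ht.
    + intros n k. destruct (Ht n) as [_ [A [B _]]]. specialize (A k). lra.
    + assert (Li : is_lim_seq (fun n => / b n) (/ lam)).
      { apply (is_lim_seq_inv b (Finite lam)); [exact Lb|]. intros E. injection E. lra. }
      assert (Hl : / lam * lam = 1) by (field; lra).
      assert (0 < / lam < 1) by (split; [apply Rinv_0_lt_compat; lra|nra]).
      apply is_lim_seq_le_le with
        (fun n => 1 - (1 - lam / b n) / (1 - / b n * / b n)) (fun _ => 1).
      * intros n. destruct (Ht n) as [_ [_ [A B]]]. lra.
      * replace (Finite 1) with (Finite (1 - (1 - lam * / lam) / (1 - / lam * / lam))).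
        2: { f_equal. rewrite Rinv_r by lra. unfold Rdiv. ring. }
        apply is_lim_seq_minus'; [apply is_lim_seq_const|].
        apply is_lim_seq_div'; [| |nra].
        -- apply is_lim_seq_minus'; [apply is_lim_seq_const|].
           apply is_lim_seq_mult'; [apply is_lim_seq_const|exact Li].
        -- apply is_lim_seq_minus'; [apply is_lim_seq_const|].
           now apply is_lim_seq_mult'.
      * apply is_lim_seq_const.
    + now exists s.
  - right. intros beta Hb. destruct (Hm beta) as [m [Hm1 Hm2]]; [lra|].
    destruct (subcritical_orbit beta m 1) as [t [A [B [C _]]]]; trivial; try lra.
    { intros n. rewrite pow1. apply nwords_ge_1. }
    now exists t.
Qed.

End Counting.

(** * Renormalization *)

(** At a level, [h] and [g] are the lengths of the images of 0 and 1 under the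
    corresponding power of [phi]; the boolean is the parity of the power. *)
Inductive level : bool -> nat -> nat -> Prop :=
| level_0 : level false 1 1
| level_S p h g : level p h g -> level (negb p) g (g + 2 * h).

Lemma level_spec p h g : level p h g ->
  (1 <= h <= g)%nat /\ (if p then g = 2 * h + 1 else g + 1 = 2 * h)%nat.
Proof.
  induction 1 as [|p h g _ [IH1 IH2]]; [lia|]. destruct p; simpl negb; cbn iota; lia.
Qed.

(** The coordinate of the point 1 at a level. *)
Definition tau (p : bool) (beta : R) : R :=
  if p then 1 / (beta + 1) else beta / (beta + 1).

(** The map induced on block beginnings, in a coordinate in which the letter 0 acts
    linearly; at level 0 both slopes are [- beta]. *)
Definition skew_orbit (s0 s1 : R) (b : nat -> bool) (y : nat -> R) : Prop :=
  forall i, y (S i) = if b i then 1 - s1 * y i else - s0 * y i.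

Lemma tau_bounds p beta : 1 < beta -> 0 < tau p beta < 1 /\ tau p beta * (beta + 1) = if p then 1 else beta.
Proof.
  intros H. assert (E : tau p beta * (beta + 1) = if p then 1 else beta).
  { unfold tau. destruct p; field; lra. }
  split; [|exact E]. destruct p; nra.
Qed.

Lemma level_slopes p h g beta : level p h g -> 1 < beta ->
  1 < beta ^ h /\ beta ^ h <= beta ^ g /\
  (if p then beta ^ g = beta * (beta ^ h * beta ^ h)
   else beta ^ h * beta ^ h = beta * beta ^ g).
Proof.
  intros L Hb. destruct (level_spec _ _ _ L) as [H1 H2]. split; [|split].
  - apply Rlt_pow_R1; [easy|lia].
  - apply Rle_pow; [lra|lia].
  - rewrite <- pow_add. destruct p.
    + replace g with (S (h + h)) by lia. reflexivity.
    + replace (h + h)%nat with (S g) by lia. reflexivity.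
Qed.

Section Skew.
Variables (s0 s1 T : R) (b : nat -> bool) (y : nat -> R).
Hypothesis Hs0 : 1 < s0.
Hypothesis Hs1 : 0 < s1.
Hypothesis HT : 0 < T < 1.
Hypothesis Hy : skew_orbit s0 s1 b y.
Hypothesis HyT : forall i, y i <= T.

Lemma skew_true i : b i = true -> y (S i) = 1 - s1 * y i.
Proof. intros E. rewrite (Hy i), E. reflexivity. Qed.

Lemma skew_false i : b i = false -> y (S i) = - s0 * y i.
Proof. intros E. rewrite (Hy i), E. reflexivity. Qed.

Lemma skew_pos i : b i = true -> 0 < y i.
Proof. intros E. assert (H := skew_true i E). specialize (HyT (S i)). nra. Qed.

Lemma skew_lower i : - T <= s0 * y i.
Proof.
  destruct (b i) eqn:E.
  - assert (H := skew_pos i E). nra.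
  - assert (H := skew_false i E). specialize (HyT (S i)). lra.
Qed.

(** After a letter 1 the orbit is at least [1 - s1 * T > 0]; an odd number of
    letters 0 makes it negative, which no letter 1 allows, and four letters 0
    bring it above [T]. *)
Lemma skew_blocks :
  0 < 1 - s1 * T -> T < (1 - s1 * T) * (s0 * s0 * s0 * s0) ->
  forall i, b i = true -> b (i + 1)%nat = true \/
    (b (i + 1)%nat = false /\ b (i + 2)%nat = false /\ b (i + 3)%nat = true).
Proof.
  intros H1 H2 i Hi. assert (E := skew_true i Hi).
  assert (Ey : 1 - s1 * T <= y (S i)) by (specialize (HyT i); nra).
  replace (i + 1)%nat with (S i) by lia. replace (i + 2)%nat with (S (S i)) by lia.
  replace (i + 3)%nat with (S (S (S i))) by lia.
  destruct (b (S i)) eqn:E1; [now left|right]. apply skew_false in E1.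
  destruct (b (S (S i))) eqn:E2.
  { exfalso. apply skew_pos in E2. nra. }
  apply skew_false in E2.
  destruct (b (S (S (S i)))) eqn:E3; [easy|]. apply skew_false in E3.
  destruct (b (S (S (S (S i))))) eqn:E4.
  { exfalso. apply skew_pos in E4. rewrite E3, E2, E1 in E4.
    assert (0 < s0 * (s0 * s0)) by nra. nra. }
  apply skew_false in E4. exfalso. specialize (HyT (S (S (S (S (S i)))))).
  assert (Q : y (S (S (S (S (S i))))) = s0 * s0 * s0 * s0 * y (S i)).
  { rewrite E4, E3, E2, E1. ring. }
  assert (1 < s0 * s0) by nra. assert (1 < s0 * s0 * s0 * s0) by nra. nra.
Qed.

(** Starting at the maximum [T], the letter 0 would lead below the lower bound
    [- T / s0], and the word 11 would lead above [T]. *)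
Lemma skew_starts_10 :
  y 0%nat = T -> 1 < s1 -> 1 < T * (s1 + 1) -> b 0%nat = true /\ b 1%nat = false.
Proof.
  intros H0 H1 H2. assert (E0 : b 0%nat = true).
  { destruct (b 0%nat) eqn:E; [easy|]. exfalso. apply skew_false in E.
    assert (H := skew_lower 1). rewrite E, H0 in H. assert (1 < s0 * s0) by nra. nra. }
  split; [easy|]. destruct (b 1%nat) eqn:E1; [|easy]. exfalso.
  apply skew_true in E0, E1. specialize (HyT 2%nat).
  rewrite E1, E0, H0 in HyT. nra.
Qed.

End Skew.

(** [b] is the image of [b'] under the substitution [phi], with true for 1; the
    image of the [j]-th letter begins at [pos j]. *)
Definition desubst (b b' : nat -> bool) (pos : nat -> nat) : Prop :=
  pos 0%nat = 0%nat /\ forall j, b (pos j) = true /\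
    if b' j then b (pos j + 1)%nat = false /\ b (pos j + 2)%nat = false /\
      pos (S j) = (pos j + 3)%nat
    else pos (S j) = (pos j + 1)%nat.

Lemma desubst_exists b :
  b 0%nat = true ->
  (forall i, b i = true -> b (i + 1)%nat = true \/
    (b (i + 1)%nat = false /\ b (i + 2)%nat = false /\ b (i + 3)%nat = true)) ->
  exists b' pos, desubst b b' pos.
Proof.
  intros H0 H.
  set (pos := fix pos j := match j with O => O | S j =>
    if b (pos j + 1)%nat then (pos j + 1)%nat else (pos j + 3)%nat end).
  assert (Hp : forall j, b (pos j) = true).
  { induction j as [|j IH]; [exact H0|]. simpl. specialize (H _ IH).
    destruct (b (pos j + 1)%nat) eqn:E; [exact E|]. now destruct H as [H|H]. }
  exists (fun j => negb (b (pos j + 1)%nat)), pos. split; [easy|].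
  intros j. split; [apply Hp|]. specialize (H _ (Hp j)). simpl.
  destruct (b (pos j + 1)%nat) eqn:E; simpl; [easy|]. now destruct H as [H|H].
Qed.

(** The blocks 100 and 1 act as a skew map again, after the affine change of
    coordinate that moves the fixed point [1 / (1 + s1)] of the letter 1 to 0
    and normalizes the constant of the block 100. *)
Lemma skew_desubst s0 s1 b y b' pos :
  1 < s0 -> 0 < s1 -> skew_orbit s0 s1 b y -> desubst b b' pos ->
  skew_orbit s1 (s1 * (s0 * s0)) b'
    (fun j => (y (pos j) - 1 / (1 + s1)) / ((s0 * s0 - 1) / (1 + s1))).
Proof.
  intros H0 H1 Hy [_ H] j. destruct (H j) as [A B].
  assert (N : s0 * s0 - 1 <> 0) by nra.
  apply (skew_true _ _ _ _ Hy) in A. destruct (b' j).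
  - destruct B as [B1 [B2 B3]]. rewrite B3.
    replace (pos j + 3)%nat with (S (S (S (pos j)))) by lia.
    replace (pos j + 1)%nat with (S (pos j)) in B1 by lia.
    replace (pos j + 2)%nat with (S (S (pos j))) in B2 by lia.
    apply (skew_false _ _ _ _ Hy) in B1, B2. rewrite B2, B1, A. field. split; lra.
  - rewrite B. replace (pos j + 1)%nat with (S (pos j)) by lia. rewrite A. field. split; lra.
Qed.

Definition level_orbit (p : bool) (h g : nat) (beta : R) (b : nat -> bool) (y : nat -> R) :=
  skew_orbit (beta ^ h) (beta ^ g) b y /\ forall i, y i <= tau p beta.

(** The change of coordinate maps [tau p beta] to [tau (negb p) beta]. *)
Lemma level_orbit_desubst p h g beta b y b' pos :
  level p h g -> 1 < beta -> level_orbit p h g beta b y -> desubst b b' pos ->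
  exists y', level_orbit (negb p) g (g + 2 * h) beta b' y' /\
    (y 0%nat = tau p beta -> y' 0%nat = tau (negb p) beta).
Proof.
  intros L Hb [Hy HT] D. destruct (level_slopes _ _ _ _ L Hb) as [A [B C]].
  set (s0 := beta ^ h) in *. set (s1 := beta ^ g) in *.
  assert (D0 := proj1 D).
  assert (Hs := skew_desubst s0 s1 b y b' pos A ltac:(lra) Hy D).
  set (c := (s0 * s0 - 1) / (1 + s1)) in *.
  assert (Hc : 0 < c) by (unfold c; apply Rdiv_lt_0_compat; nra).
  assert (E : (tau p beta - 1 / (1 + s1)) / c = tau (negb p) beta).
  { unfold c, tau. assert (s0 * s0 - 1 <> 0) by nra.
    destruct p; simpl negb; cbn iota.
    - rewrite C. field. repeat split; nra.
    - apply (Rmult_eq_reg_r ((s0 * s0 - 1) * (beta + 1))); [|nra].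
      transitivity (beta * s1 - 1); [field; repeat split; nra|].
      transitivity (s0 * s0 - 1); [rewrite C; ring|field; lra]. }
  eexists. split; [split|].
  - fold s1. replace (beta ^ (g + 2 * h)) with (s1 * (s0 * s0)); [exact Hs|].
    unfold s0, s1. rewrite <- !pow_add. f_equal. lia.
  - intros i. cbv beta. rewrite <- E. unfold Rdiv at 1 3.
    apply Rmult_le_compat_r; [apply Rlt_le, Rinv_0_lt_compat, Hc|].
    specialize (HT (pos i)). lra.
  - cbv beta. intros H0. rewrite D0, H0. exact E.
Qed.

(** In the coordinate centred at the fixed point of the digit 0, the digits 0
    and 1 act with equal slopes. *)
Lemma level_orbit_0 beta (b : nat -> bool) (a : nat -> Z) t :
  1 < beta -> (forall n, a n = Z.b2z (b n)) -> orbit beta a t ->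
  (forall k, t k <= 1) ->
  level_orbit false 1 1 beta b (fun k => t k - 1 / (beta + 1)).
Proof.
  intros Hb Ha Ho Ht. split.
  - intros i. cbv beta. rewrite Ho, Ha. destruct (b i); simpl; field; lra.
  - intros i. specialize (Ht i). unfold tau.
    replace (beta / (beta + 1)) with (1 - 1 / (beta + 1)) by (field; lra). lra.
Qed.

(** The condition of [skew_starts_10] holds because [beta * s1 > 1] at even
    levels, and [s1 > beta] at odd ones. *)
Lemma level_starts_10 p h g beta b y :
  level p h g -> 1 < beta -> level_orbit p h g beta b y -> y 0%nat = tau p beta ->
  b 0%nat = true /\ b 1%nat = false.
Proof.
  intros L Hb [Hy HT] H0. destruct (level_slopes _ _ _ _ L Hb) as [A [B C]].
  destruct (tau_bounds p beta Hb) as [D E].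
  apply (skew_starts_10 (beta ^ h) (beta ^ g) (tau p beta) b y); trivial; try lra.
  apply Rmult_lt_reg_r with (beta + 1); [lra|].
  replace (tau p beta * (beta ^ g + 1) * (beta + 1))
    with ((if p then 1 else beta) * (beta ^ g + 1)) by (rewrite <- E; ring).
  clear - A B C Hb. revert A B C. generalize (beta ^ h), (beta ^ g). intros s0 s1 A B C.
  assert (1 < s0 * s0) by nra. destruct p; nra.
Qed.

(** * Two orbits of one sequence *)

(** The same letters [b] are read by an orbit [y] with slopes [- s0], [- s1] and
    by an orbit [z] with the larger slopes [- S0], [- S1]. In each step the
    difference [y - z] is multiplied by [- S0] or [- S1], and changed by a multiple
    of [y] that measures how much the slopes differ. It has to be shown that the
    change does not compensate the growth. *)
Section Pair.
Variables (s0 s1 T S0 S1 T' : R) (b : nat -> bool) (y z : nat -> R).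
Hypothesis Hs0 : 1 < s0.
Hypothesis Hs : s0 <= s1.
Hypothesis HS0 : s0 <= S0.
Hypothesis HS1 : s1 < S1.
Hypothesis HS : S0 <= S1.
Hypothesis Hq : s1 * S0 <= s0 * S1.
Hypothesis HT : 0 < T < 1.
Hypothesis HT' : 0 < T' < 1.
Hypothesis Hy : skew_orbit s0 s1 b y.
Hypothesis Hz : skew_orbit S0 S1 b z.
Hypothesis HyT : forall i, y i <= T.
Hypothesis HzT : forall i, z i <= T'.

Lemma pair_lower i : - T <= y i.
Proof.
  assert (H := skew_lower s0 s1 T b y Hs0 ltac:(lra) HT Hy HyT i). nra.
Qed.

Lemma pair_lower' i : - T' <= z i.
Proof.
  assert (H := skew_lower S0 S1 T' b z ltac:(lra) ltac:(lra) HT' Hz HzT i). nra.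
Qed.

Lemma pair_bounded i : Rabs (y i - z i) < 2.
Proof.
  assert (A := pair_lower i). assert (B := pair_lower' i).
  assert (C := HyT i). assert (D := HzT i). apply Rabs_def1; lra.
Qed.

Lemma pair_true i : b i = true ->
  y (S i) - z (S i) = - S1 * (y i - z i) + (S1 - s1) * y i.
Proof. intros E. rewrite (Hy i), (Hz i), E. ring. Qed.

Lemma pair_false i : b i = false ->
  y (S i) - z (S i) = - S0 * (y i - z i) + (S0 - s0) * y i.
Proof. intros E. rewrite (Hy i), (Hz i), E. ring. Qed.

(** The bound [M * S1] on [(S1 - s1) * y] also serves for the letter 0, because
    [s0 / S0] is at least [s1 / S1]. *)
Lemma pair_step i M :
  T * (S1 - s1) = M * S1 ->
  M <= Rabs (y i - z i) ->
  S0 * (Rabs (y i - z i) - M) <= Rabs (y (S i) - z (S i)).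
Proof.
  intros HM H. assert (Ay : Rabs (y i) <= T).
  { assert (A := pair_lower i). assert (C := HyT i). apply Rabs_le. lra. }
  assert (Py := Rabs_pos (y i)).
  assert (G : forall c d, S0 <= c -> 0 <= d -> d * T <= c * M ->
    S0 * (Rabs (y i - z i) - M) <= Rabs (- c * (y i - z i) + d * y i)).
  { intros c d Hc Hd HdM.
    assert (Q := Rabs_triang_inv (c * (y i - z i)) (d * y i)).
    replace (- c * (y i - z i) + d * y i) with (- (c * (y i - z i) - d * y i)) by ring.
    rewrite Rabs_Ropp. rewrite !Rabs_mult, (Rabs_pos_eq c), (Rabs_pos_eq d) in Q by lra.
    assert (d * Rabs (y i) <= c * M) by nra. nra. }
  destruct (b i) eqn:E.
  - rewrite pair_true by easy. apply G; lra.
  - rewrite pair_false by easy. apply G; try lra.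
    assert ((S0 - s0) * S1 <= S0 * (S1 - s1)) by nra.
    apply Rmult_le_reg_r with S1; [lra|]. nra.
Qed.

(** [pair_step] gives the lower estimate [d -> S0 * (d - M)], whose iterates tend
    to infinity from any point beyond its fixed point. *)
Lemma pair_escape i M :
  T * (S1 - s1) = M * S1 -> S0 * M < (S0 - 1) * Rabs (y i - z i) -> False.
Proof.
  intros HM H. assert (M0 : 0 < M) by nra.
  set (F := S0 * M / (S0 - 1)).
  assert (HF : F * (S0 - 1) = S0 * M) by (unfold F; field; lra).
  assert (FM : M <= F) by nra.
  assert (Hd : 0 < Rabs (y i - z i) - F) by nra.
  assert (G : forall n, F + S0 ^ n * (Rabs (y i - z i) - F) <= Rabs (y (n + i)%nat - z (n + i)%nat)).
  { induction n as [|n IH]; [simpl; lra|].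
    assert (P : 0 < S0 ^ n) by (apply pow_lt; lra).
    assert (0 < S0 ^ n * (Rabs (y i - z i) - F)) by nra.
    simpl pow. simpl Nat.add.
    apply Rle_trans with (2 := pair_step (n + i) M HM ltac:(lra)). nra. }
  destruct (pow_unbounded S0 2 (Rabs (y i - z i) - F)) as [n Hn]; [lra|easy|].
  specialize (G n). assert (B := pair_bounded (n + i)). assert (0 < F) by lra. lra.
Qed.

(** While only letters 0 are read, the change increases the difference further,
    because [y] has the opposite sign; the first letter 1 comes when [y > 0], and
    then the change has a favourable sign again. *)
Lemma pair_run P :
  0 < P -> y 1%nat <= 0 -> P <= y 1%nat - z 1%nat ->
  exists i, S1 * S0 * P <= y i - z i.
Proof.
  intros HP H1 HP1.
  assert (G : forall n, (exists i, S1 * S0 * P <= y i - z i) \/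
    ((y (S n) <= 0 /\ S0 ^ n * P <= y (S n) - z (S n)) \/
     ((1 <= n)%nat /\ 0 <= y (S n) /\ y (S n) - z (S n) <= - (S0 ^ n * P)))).
  { induction n as [|n [IH|IH]]; [right; left; simpl; lra|now left|].
    destruct (b (S n)) eqn:E.
    - left. assert (E1 := skew_pos s0 s1 T b y ltac:(lra) HT Hy HyT _ E).
      destruct IH as [IH|[Hn IH]]; [lra|]. exists (S (S n)). rewrite pair_true by easy.
      assert (S0 <= S0 ^ n).
      { rewrite <- (pow_1 S0) at 1. apply Rle_pow; [lra|easy]. }
      assert (S0 * P <= S0 ^ n * P) by nra. nra.
    - right. rewrite (pair_false (S n)) by easy. rewrite (skew_false _ _ _ _ Hy _ E). simpl pow.
      destruct IH as [IH|[Hn IH]]; [right|left]; repeat split; try lia; nra. }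
  destruct (pow_unbounded S0 2 P) as [n Hn]; [lra|easy|].
  destruct (G n) as [H|H]; [easy|]. assert (B := pair_bounded (S n)). exfalso.
  apply Rabs_def2 in B. destruct H as [H|H]; lra.
Qed.

(** The hypothesis [1 - s1 * T <= 0] says that the first run of letters 0 is odd or
    infinite. The difference at time 1 is at least [kappa * S1 * M]; the run and
    the letter 1 after it multiply this by [S0 * S1], which is enough to escape. *)
Lemma pair_odd_run kappa :
  b 0%nat = true -> y 0%nat = T -> 1 - s1 * T <= 0 -> 0 < kappa ->
  z 0%nat - T >= - (1 - kappa) * (T * (1 - s1 / S1)) ->
  1 < kappa * (S1 * S1) * (S0 - 1) -> False.
Proof.
  intros E0 H0 H1 Hk Hz0 HK. set (M := T * (1 - s1 / S1)) in *.
  assert (HM : T * (S1 - s1) = M * S1) by (unfold M; field; lra).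
  assert (M0 : 0 < M) by nra.
  assert (P1 := pair_true 0 E0).
  destruct (pair_run (kappa * S1 * M)) as [i Hi].
  - assert (0 < kappa * S1) by nra. nra.
  - rewrite (skew_true _ _ _ _ Hy _ E0), H0. exact H1.
  - rewrite P1, H0. nra.
  - apply (pair_escape i M HM). rewrite Rabs_pos_eq.
    2: { assert (0 < S1 * S0) by nra. assert (0 < kappa * S1 * M).
         { assert (0 < kappa * S1) by nra. nra. } nra. }
    apply Rlt_le_trans with ((S0 - 1) * (S1 * S0 * (kappa * S1 * M))).
    + replace ((S0 - 1) * (S1 * S0 * (kappa * S1 * M)))
        with (S0 * M * (kappa * (S1 * S1) * (S0 - 1))) by ring.
      assert (0 < S0 * M) by nra. nra.
    + apply Rmult_le_compat_l; lra.
Qed.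

(** Now [y > 0] after every letter 1, so that all runs of letters 0 are even. *)
Hypothesis H1pos : 0 < 1 - s1 * T.

(** A run of letters 0 is finite, since [y] is bounded; it is even, since [y > 0]
    is needed at its end. *)
Lemma pair_next_one i : b i = true -> exists k,
  b (S i + 2 * k)%nat = true /\ y (S i + 2 * k)%nat = (s0 * s0) ^ k * y (S i) /\
  z (S i + 2 * k)%nat = (S0 * S0) ^ k * z (S i).
Proof.
  intros E. assert (E1 := skew_true _ _ _ _ Hy _ E).
  assert (Hy1 : 0 < y (S i)) by (specialize (HyT i); nra).
  assert (Hss : 1 < s0 * s0) by nra.
  assert (G : forall n, (exists k,
    b (S i + 2 * k)%nat = true /\ y (S i + 2 * k)%nat = (s0 * s0) ^ k * y (S i) /\
    z (S i + 2 * k)%nat = (S0 * S0) ^ k * z (S i)) \/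
    (y (S i + 2 * n)%nat = (s0 * s0) ^ n * y (S i) /\
     z (S i + 2 * n)%nat = (S0 * S0) ^ n * z (S i))).
  { induction n as [|n [IH|[IH1 IH2]]]; [right|now left|].
    - rewrite Nat.mul_0_r, Nat.add_0_r. simpl. lra.
    - assert (0 < (s0 * s0) ^ n) by (apply pow_lt; lra).
      assert (Hn : 0 < y (S i + 2 * n)%nat) by (rewrite IH1; nra).
      destruct (b (S i + 2 * n)%nat) eqn:F; [left; now exists n|right].
      replace (S i + 2 * S n)%nat with (S (S (S i + 2 * n))) by lia.
      assert (F1 := skew_false _ _ _ _ Hy _ F). assert (F2 := skew_false _ _ _ _ Hz _ F).
      destruct (b (S (S i + 2 * n))) eqn:F'.
      + apply (skew_pos s0 s1 T b y) in F'; trivial; try lra. nra.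
      + rewrite (skew_false _ _ _ _ Hy _ F'), (skew_false _ _ _ _ Hz _ F'), F1, F2, IH1, IH2.
        simpl. split; ring. }
  destruct (pow_unbounded (s0 * s0) T (y (S i))) as [n Hn]; [easy|easy|].
  destruct (G n) as [H|[H _]]; [easy|]. specialize (HyT (S i + 2 * n)%nat). lra.
Qed.

Variables (r delta : R).
Hypothesis Hr : 0 <= r.
Hypothesis Hdelta : 0 <= delta.
Hypothesis Hratio :
  1 - (s0 * s0) / (S0 * S0) <= r * (1 - s1 / S1).

(** Here [1 - P ^ k <= k * (1 - P)], and [r] compares the two kinds of defect. *)
Lemma ratio_pow k :
  1 - s1 / S1 * ((s0 * s0) / (S0 * S0)) ^ k <= (1 - s1 / S1) * (1 + r * INR k).
Proof.
  set (Q := s1 / S1) in *. set (P := (s0 * s0) / (S0 * S0)) in *.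
  assert (HQ : 0 < Q < 1).
  { unfold Q. split; [apply Rdiv_lt_0_compat; lra|].
    apply Rmult_lt_reg_r with S1; [lra|]. unfold Rdiv. rewrite Rmult_assoc, Rinv_l; lra. }
  assert (HP : 0 < P <= 1).
  { unfold P. split; [apply Rdiv_lt_0_compat; nra|].
    apply Rmult_le_reg_r with (S0 * S0); [nra|]. unfold Rdiv.
    rewrite Rmult_assoc, Rinv_l; nra. }
  assert (G : 1 - P ^ k <= INR k * (1 - P) /\ 0 < P ^ k <= 1).
  { induction k as [|k IH]; [simpl; lra|]. rewrite S_INR. simpl. split; [|nra]. nra. }
  assert (K := pos_INR k).
  assert (INR k * (1 - P) <= INR k * (r * (1 - Q))) by nra. nra.
Qed.

(** Between two letters 1 with [2 * k] letters 0 in between, the change of the slopes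
    enters through the defects that [ratio_pow] bounds. *)
Lemma pair_double i k :
  b i = true -> b (S i + 2 * k)%nat = true ->
  y (S i + 2 * k)%nat = (s0 * s0) ^ k * y (S i) ->
  z (S i + 2 * k)%nat = (S0 * S0) ^ k * z (S i) ->
  S1 * (S0 * S0) ^ k * (S1 * (z i - y i)
    + (1 - s1 / S1) * (S1 * y i - (1 + r * INR k) * y (S i)))
  <= z (S (S i + 2 * k)) - y (S (S i + 2 * k)).
Proof.
  intros E E' Yk Zk.
  rewrite (skew_true _ _ _ _ Hy _ E'), (skew_true _ _ _ _ Hz _ E'), Yk, Zk.
  assert (R := ratio_pow k). assert (Y1 := skew_true _ _ _ _ Hy _ E).
  assert (Z1 := skew_true _ _ _ _ Hz _ E).
  assert (Ypos : 0 < y (S i)) by (specialize (HyT i); nra).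
  set (A := (S0 * S0) ^ k). assert (HA : 0 < A) by (apply pow_lt; nra).
  assert (HC : (s0 * s0) ^ k = A * ((s0 * s0) / (S0 * S0)) ^ k).
  { unfold A. rewrite <- Rpow_mult_distr. f_equal. field. nra. }
  rewrite HC. set (P := ((s0 * s0) / (S0 * S0)) ^ k) in *.
  set (Q := s1 / S1) in *. assert (HQ : s1 = Q * S1) by (unfold Q; field; lra).
  replace (1 - S1 * (A * z (S i)) - (1 - s1 * (A * P * y (S i))))
    with (S1 * A * (Q * P * y (S i) - z (S i))) by (rewrite HQ; ring).
  apply Rmult_le_compat_l; [nra|].
  assert (U : y (S i) * (1 - Q * P) <= y (S i) * ((1 - Q) * (1 + r * INR k)))
    by (apply Rmult_le_compat_l; lra).
  rewrite Z1. assert (y (S i) = 1 - Q * S1 * y i) by (rewrite Y1, HQ; ring). nra.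
Qed.

Hypothesis Hgrow : forall k, (2 + r * INR k) * T <= (1 + delta) * (s0 * s0) ^ k.

(** A positive [z - y] at a letter 1 becomes negative after it, and positive again
    after the next letter 1, multiplied by at least [S1 ^ 2]. The loss
    [(1 - s1 / S1) * delta] comes from short runs of letters 0 between the two. *)
Lemma pair_double_next i E :
  b i = true -> E <= z i - y i -> (1 - s1 / S1) * delta <= S1 * E ->
  exists j, b j = true /\ S1 * (S1 * E - (1 - s1 / S1) * delta) <= z j - y j.
Proof.
  intros Hi HE HEd. destruct (pair_next_one i Hi) as [k [E' [Yk Zk]]].
  assert (D := pair_double i k Hi E' Yk Zk).
  assert (Y1 := skew_true _ _ _ _ Hy _ Hi).
  assert (Ypos : 0 < y (S i)) by (assert (L := HyT i); nra).
  set (Q := s1 / S1) in *. assert (HQ : s1 = Q * S1) by (unfold Q; field; lra).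
  assert (HQ1 : 0 < Q < 1) by nra.
  assert (Hw : (2 + r * INR k) * y (S i) <= 1 + delta).
  { assert (P : 0 < (s0 * s0) ^ k) by (apply pow_lt; nra).
    assert (L := HyT (S i + 2 * k)%nat). rewrite Yk in L. assert (K := pos_INR k).
    specialize (Hgrow k). assert (0 <= 2 + r * INR k) by nra.
    apply Rmult_le_reg_r with ((s0 * s0) ^ k); [easy|]. nra. }
  assert (Hb : S1 * E - (1 - Q) * delta <= S1 * (z i - y i)
    + (1 - Q) * (S1 * y i - (1 + r * INR k) * y (S i))).
  { assert (s1 * y i = 1 - y (S i)) by lra.
    assert (Yi : 0 < y i) by (apply (skew_pos s0 s1 T b y); trivial; lra).
    assert (s1 * y i <= S1 * y i) by nra.
    assert (- delta <= S1 * y i - (1 + r * INR k) * y (S i)) by lra. nra. }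
  assert (HA : 1 <= (S0 * S0) ^ k) by (apply pow_R1_Rle; nra).
  destruct (pair_next_one _ E') as [k' [E'' [Yk' Zk']]].
  exists (S (S i + 2 * k) + 2 * k')%nat. split; [exact E''|]. rewrite Yk', Zk'.
  assert (Y2pos : 0 < y (S (S i + 2 * k))).
  { rewrite (skew_true _ _ _ _ Hy _ E'). assert (L := HyT (S i + 2 * k)%nat). nra. }
  assert (HA' : 1 <= (S0 * S0) ^ k') by (apply pow_R1_Rle; nra).
  assert (HB' : (s0 * s0) ^ k' <= (S0 * S0) ^ k') by (apply pow_incr; nra).
  set (X := S1 * E - (1 - Q) * delta) in *.
  assert (X0 : 0 <= X) by (unfold X; lra).
  assert (L1 : S1 * X <= z (S (S i + 2 * k)) - y (S (S i + 2 * k))).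
  { apply Rle_trans with (2 := D).
    apply Rle_trans with (S1 * (S0 * S0) ^ k * X); [|apply Rmult_le_compat_l; nra].
    assert (0 <= S1 * X) by nra. nra. }
  assert (0 <= S1 * X) by nra. nra.
Qed.

(** The first two letters 1 bring [z - y] above the fixed point [F] of the
    recursion of [pair_double_next], even if [z 0 < y 0]. *)
Lemma pair_even_run :
  b 0%nat = true -> b 1%nat = false -> y 0%nat = T ->
  (forall k, (1 <= k)%nat -> (s0 * s0) ^ k * (1 - s1 * T) <= T ->
    (1 - s1 / S1) * delta < (S1 * S1 - 1) * (S0 * S0) *
      (S1 * (z 0%nat - T) + (1 - s1 / S1) * (S1 * T - (1 + r * INR k) * (1 - s1 * T)))) ->
  False.
Proof.
  intros E0 E1 H0 Hk. set (Q := s1 / S1) in *.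
  assert (HQ : s1 = Q * S1) by (unfold Q; field; lra).
  assert (HQ1 : 0 < Q < 1) by nra.
  set (F := S1 * ((1 - Q) * delta) / (S1 * S1 - 1)).
  assert (HS1' : 1 < S1 * S1) by nra.
  assert (HF : F * (S1 * S1 - 1) = S1 * ((1 - Q) * delta)) by (unfold F; field; lra).
  assert (Qd : 0 <= (1 - Q) * delta) by nra.
  assert (F0 : 0 <= F) by nra.
  assert (HFd : (1 - Q) * delta <= S1 * F).
  { assert (S1 * F * (S1 * S1 - 1) = S1 * S1 * ((1 - Q) * delta)) by (rewrite Rmult_assoc, HF; ring).
    apply Rmult_le_reg_r with (S1 * S1 - 1); [lra|]. nra. }
  assert (Start : exists i, b i = true /\ F < z i - y i).
  { destruct (pair_next_one 0 E0) as [k [E' [Yk Zk]]].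
    assert (D := pair_double 0 k E0 E' Yk Zk). fold Q in D.
    destruct k as [|k]; [simpl in E'; congruence|].
    specialize (Hk (S k) ltac:(lia)).
    rewrite (skew_true _ _ _ _ Hy _ E0), H0 in D.
    assert (L := HyT (1 + 2 * S k)%nat). rewrite Yk in L.
    rewrite (skew_true _ _ _ _ Hy _ E0), H0 in L. specialize (Hk L).
    set (X := S1 * (z 0%nat - T) + (1 - Q) * (S1 * T - (1 + r * INR (S k)) * (1 - s1 * T))) in *.
    destruct (pair_next_one _ E') as [k' [E'' [Yk' Zk']]].
    exists (S (1 + 2 * S k) + 2 * k')%nat. split; [exact E''|]. rewrite Yk', Zk'.
    set (i := (1 + 2 * S k)%nat) in *.
    assert (Y2pos : 0 < y (S i)).
    { rewrite (skew_true _ _ _ _ Hy _ E'). assert (L' := HyT i). nra. }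
    assert (HA' : 1 <= (S0 * S0) ^ k') by (apply pow_R1_Rle; nra).
    assert (HB' : (s0 * s0) ^ k' <= (S0 * S0) ^ k') by (apply pow_incr; nra).
    assert (HA : S0 * S0 <= (S0 * S0) ^ S k).
    { rewrite <- (pow_1 (S0 * S0)) at 1. apply Rle_pow; [nra|lia]. }
    assert (SS : 1 < S0 * S0) by nra.
    assert (X0 : 0 < X).
    { assert (0 < (S1 * S1 - 1) * (S0 * S0)) by nra. nra. }
    assert (FX : F < S1 * (S0 * S0) * X).
    { apply Rmult_lt_reg_r with (S1 * S1 - 1); [lra|]. rewrite HF.
      replace (S1 * (S0 * S0) * X * (S1 * S1 - 1)) with (S1 * ((S1 * S1 - 1) * (S0 * S0) * X)) by ring.
      apply Rmult_lt_compat_l; lra. }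
    assert (S1 * (S0 * S0) * X <= S1 * (S0 * S0) ^ S k * X).
    { apply Rmult_le_compat_r; [lra|]. apply Rmult_le_compat_l; lra. }
    change (1 + 2 * S k)%nat with i in D.
    assert (0 < z (S i) - y (S i)) by lra. nra. }
  destruct Start as [i [Ei Hi]]. set (d := z i - y i - F). assert (Hd : 0 < d) by (unfold d; lra).
  assert (G : forall n, exists j, b j = true /\ F + (S1 * S1) ^ n * d <= z j - y j).
  { induction n as [|n [j [Ej Hj]]]; [exists i; split; [easy|unfold d; simpl; lra]|].
    assert (P : 0 < (S1 * S1) ^ n * d) by (apply Rmult_lt_0_compat; [apply pow_lt; lra|easy]).
    destruct (pair_double_next j _ Ej Hj) as [j' [Ej' Hj']].
    { fold Q. nra. }
    exists j'. split; [easy|]. apply Rle_trans with (2 := Hj'). fold Q. simpl.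
    apply Req_le.
    transitivity (S1 * S1 * F - S1 * ((1 - Q) * delta) + S1 * S1 * (S1 * S1) ^ n * d); [|ring].
    rewrite <- HF. ring. }
  destruct (pow_unbounded (S1 * S1) 2 d HS1' Hd) as [n Hn].
  destruct (G n) as [j [_ Hj]]. assert (B := pair_bounded j). apply Rabs_def2 in B. lra.
Qed.

End Pair.

(** * Numerical estimates *)

(** The difference of the orbits is positive at odd times, and if [eta] exceeds the
    golden mean it stays above the fixed point [F < 1] (times [eta - beta]) of its
    lower estimate over two steps. *)
Lemma golden_unique beta eta a t w :
  1 < beta < eta -> eta + 1 < eta * eta ->
  expands_one beta a t -> expands_one eta a w -> False.
Proof.
  intros [Hb He] Hg [Ho [H0 Ht]] [Ho' [H0' Hw]].
  set (F := eta / (eta * eta - 1)).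
  assert (HF : F * (eta * eta - 1) = eta) by (unfold F; field; nra).
  assert (F1 : 0 < F < 1) by nra.
  assert (Step : forall i, t (S i) - w (S i) = - eta * (t i - w i) + (eta - beta) * t i).
  { intros i. rewrite Ho, Ho'. ring. }
  assert (G : forall n, (eta - beta) * (F + (eta * eta) ^ n * (1 - F))
    <= t (S (2 * n)) - w (S (2 * n))).
  { induction n as [|n IH].
    - simpl. assert (E := Step 0%nat). rewrite H0, H0' in E. lra.
    - replace (2 * S n)%nat with (S (S (2 * n))) by lia. set (i := (2 * n)%nat) in *.
      assert (A := Step (S i)). assert (B := Step (S (S i))).
      assert (C := Ht (S i)). assert (D := Ht (S (S i))). simpl pow.
      assert (L : t (S (S i)) - w (S (S i)) <= - eta * (t (S i) - w (S i)) + (eta - beta)) by nra.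
      assert (M : - eta * (t (S (S i)) - w (S (S i))) <= t (S (S (S i))) - w (S (S (S i)))) by nra.
      assert (N : eta * eta * (t (S i) - w (S i)) - eta * (eta - beta) <= t (S (S (S i))) - w (S (S (S i)))) by nra.
      apply Rle_trans with (2 := N).
      apply Rle_trans with (eta * eta * ((eta - beta) * (F + (eta * eta) ^ n * (1 - F))) - eta * (eta - beta)).
      + replace (eta * (eta - beta)) with (F * (eta * eta - 1) * (eta - beta))
          by (rewrite HF; reflexivity).
        apply Req_le. ring.
      + assert (0 < eta * eta) by nra. nra. }
  destruct (pow_unbounded (eta * eta) 2 ((eta - beta) * (1 - F))) as [n Hn]; [nra|nra|].
  specialize (G n). assert (A := Ht (S (2 * n))). assert (B := Hw (S (2 * n))). nra.
Qed.

(** The smallest levels are not covered by the bounds for large exponents. *)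
Lemma level_cases p h g : level p h g ->
  if p then (h = 1 /\ g = 3)%nat \/ (11 <= g)%nat else (h = 1 /\ g = 1)%nat \/ (5 <= g)%nat.
Proof.
  induction 1 as [|p h g L IH]; [now left|].
  assert (A := level_spec _ _ _ L). destruct p; simpl negb; cbn iota in *; lia.
Qed.

Lemma pow_cross beta eta h g : 0 < beta <= eta -> (h <= g)%nat ->
  beta ^ g * eta ^ h <= beta ^ h * eta ^ g.
Proof.
  intros Hb L. replace g with (h + (g - h))%nat by lia. rewrite !pow_add.
  assert (0 < beta ^ h) by (apply pow_lt; lra). assert (0 < eta ^ h) by (apply pow_lt; lra).
  assert (A : beta ^ (g - h) <= eta ^ (g - h)) by (apply pow_incr; lra).
  assert (0 < beta ^ h * eta ^ h) by nra. nra.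
Qed.

Lemma pow_div beta eta n : eta <> 0 -> beta ^ n / eta ^ n = (beta / eta) ^ n.
Proof. intros H. unfold Rdiv. now rewrite Rpow_mult_distr, pow_inv. Qed.

Lemma pow_le_1_mono q m n : 0 < q < 1 -> (m <= n)%nat -> q ^ n <= q ^ m.
Proof.
  intros Hq H. induction H as [|n _ IH]; [lra|]. simpl.
  assert (0 < q ^ n) by (apply pow_lt; lra). nra.
Qed.

Lemma geometric_compare q beta g : 0 < q < 1 -> 1 < beta ->
  (1 - q ^ g) * (beta - 1) <= (1 - q) * (beta ^ g - 1).
Proof.
  intros Hq Hb. induction g as [|g IH]; [simpl; lra|]. simpl.
  assert (0 < q ^ g <= 1).
  { split; [apply pow_lt; lra|]. apply (pow_le_1_mono q 0 g Hq). lia. }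
  assert (1 <= beta ^ g) by (apply pow_R1_Rle; lra).
  assert ((1 - q) * (beta - 1) * q ^ g <= (1 - q) * (beta - 1) * beta ^ g).
  { apply Rmult_le_compat_l; [apply Rmult_le_pos|]; lra. }
  nra.
Qed.

(** From [beta + 1 <= s0 ^ 2] and [s0 ^ 2 <= s1 * (s0 ^ 2 - 1)] there remains an
    inequality for a polynomial in [s0]. *)
Lemma odd_run_even_level beta s0 s1 T S0 S1 :
  1 < beta -> 1 < s0 -> s0 <= S0 -> 0 < s1 -> s1 <= S1 -> s0 * s0 = beta * s1 ->
  T * (beta + 1) = beta -> 1 - s1 * T <= 0 -> 1 < 1 * (S1 * S1) * (S0 - 1).
Proof.
  intros Hb H0 HS0 H1 HS1 E ET Hy.
  assert (A : beta + 1 <= beta * s1) by nra.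
  assert (X : 1 < s1 * s1 * (s0 - 1)).
  { assert (B : beta <= s0 * s0 - 1) by lra.
    assert (C : s0 * s0 <= s1 * (s0 * s0 - 1)) by nra.
    assert (D : (s0 * s0) * (s0 * s0) <= (s1 * (s0 * s0 - 1)) * (s1 * (s0 * s0 - 1)))
      by (apply Rmult_le_compat; nra).
    assert (K0 : 0 < (s0 - 1) * ((s0 + 1) * (s0 + 1))) by (apply Rmult_lt_0_compat; nra).
    apply Rmult_lt_reg_r with (1 := K0).
    apply Rlt_le_trans with ((s0 * s0) * (s0 * s0)); [|apply Rle_trans with (1 := D); apply Req_le; ring].
    assert (0 <= (s0 * s0 - s0 / 2 - 5 / 8) * (s0 * s0 - s0 / 2 - 5 / 8)) by apply Rle_0_sqr.
    nra. }
  assert (s1 * s1 <= S1 * S1) by nra. nra.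
Qed.

(** As for even levels; the factor 69/100 leaves room for the decrease of [tau],
    which is estimated by [tau_true_decrease] with [c = 31/100]. *)
Lemma odd_run_odd_level beta s0 s1 T S0 S1 :
  1 < beta -> 1 < s0 -> s0 <= S0 -> 0 < s1 -> s1 <= S1 -> s1 = beta * (s0 * s0) ->
  T * (beta + 1) = 1 -> 1 - s1 * T <= 0 -> 1 < (69 / 100) * (S1 * S1) * (S0 - 1).
Proof.
  intros Hb H0 HS0 H1 HS1 E ET Hy.
  assert (A : beta + 1 <= s1) by nra.
  assert (X : 3 / 2 <= s1 * s1 * (s0 - 1)).
  { assert (B : 1 <= beta * (s0 * s0 - 1)) by nra.
    assert (C : s0 * s0 <= s1 * (s0 * s0 - 1)) by nra.
    assert (D : (s0 * s0) * s1 <= s1 * (s1 * (s0 * s0 - 1))) by nra.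
    assert (P : 3 / 2 * (s0 + 1) * (s0 * s0 - 1) <= s0 * s0 * (s0 * s0)).
    { assert (A1 := Rle_0_sqr (s0 * s0 - 3 / 4 * s0 - 119 / 100)).
      assert (A2 := Rle_0_sqr (s0 - 9 / 20)). unfold Rsqr in A1, A2. lra. }
    assert (Q : 3 / 2 * (s0 + 1) <= s0 * s0 * s1).
    { apply Rmult_le_reg_r with (s0 * s0 - 1); nra. }
    apply Rmult_le_reg_r with (s0 + 1); [lra|]. nra. }
  assert (s1 * s1 <= S1 * S1) by nra. nra.
Qed.

(** At odd levels [tau] decreases when the base grows, which works against the
    divergence of the two orbits. The loss is a fraction [c] of the gain in the
    first step; comparing [g] with a smaller exponent [m] makes this a polynomial
    condition of bounded degree. *)
Lemma tau_true_decrease beta eta g m c :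
  1 < beta < eta -> (m <= g)%nat ->
  eta * (1 - beta / eta) <= c * (eta + 1) * (1 - (beta / eta) ^ m) -> 0 <= c ->
  tau true eta - tau true beta >= - c * (tau true beta * (1 - beta ^ g / eta ^ g)).
Proof.
  intros Hb L Hc Hc0. rewrite pow_div by lra. set (q := beta / eta) in *.
  assert (Hq : 0 < q < 1).
  { unfold q. split; [apply Rdiv_lt_0_compat; lra|].
    apply Rmult_lt_reg_r with eta; [lra|]. unfold Rdiv. rewrite Rmult_assoc, Rinv_l; lra. }
  assert (A := pow_le_1_mono q m g Hq L).
  assert (E : tau true eta - tau true beta = - (tau true beta * / (eta + 1)) * (eta * (1 - q))).
  { unfold tau, q. field. lra. }
  destruct (tau_bounds true beta) as [T _]; [lra|]. rewrite E.
  assert (I : 0 < / (eta + 1)) by (apply Rinv_0_lt_compat; lra).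
  assert (B : eta * (1 - q) <= c * (eta + 1) * (1 - q ^ g)).
  { apply Rle_trans with (1 := Hc). apply Rmult_le_compat_l; [|lra]. nra. }
  assert (C : / (eta + 1) * (eta * (1 - q)) <= c * (1 - q ^ g)).
  { apply Rmult_le_reg_l with (eta + 1); [lra|]. rewrite <- Rmult_assoc, Rinv_r by lra. lra. }
  nra.
Qed.

Lemma geometric_factor_3 q : 1 - q ^ 3 = (1 - q) * (1 + q + q * q).
Proof. ring. Qed.

(** Bernoulli's inequality reduces all [k >= 2] to [k = 2]. *)
Lemma run_length_bound x y T r A B k :
  0 < x -> 0 < y -> 0 < r -> (1 <= k)%nat ->
  (1 + x) ^ k * y <= T -> (1 + x) ^ 2 * y <= T ->
  (A + 2 * r) * T <= B * (1 + x) ^ 2 -> r * T <= B * (1 + x) ^ 2 * x -> 0 < A ->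
  (A + r * INR k) * y <= B.
Proof.
  intros Hx Hy Hr Hk H1 H2 H3 H4 HA.
  assert (P2 : 0 < (1 + x) ^ 2) by (apply pow_lt; lra).
  destruct (le_lt_dec k 2) as [L|L].
  - apply le_INR in L. simpl in L. apply Rmult_le_reg_l with ((1 + x) ^ 2); [easy|].
    assert ((A + r * INR k) <= A + 2 * r) by nra.
    assert (0 < A + 2 * r) by nra.
    apply Rle_trans with ((A + 2 * r) * ((1 + x) ^ 2 * y)); [|nra].
    assert (0 < (1 + x) ^ 2 * y) by nra. nra.
  - replace k with (2 + (k - 2))%nat in * by lia. set (j := (k - 2)%nat) in *.
    rewrite plus_INR. rewrite pow_add in H1. simpl (INR 2).
    assert (K := pos_INR j). assert (Bn := poly j x Hx).
    assert (H5 : (1 + x) ^ 2 * (1 + INR j * x) * y <= T).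
    { apply Rle_trans with (2 := H1). apply Rmult_le_compat_r; [lra|].
      apply Rmult_le_compat_l; lra. }
    assert (J0 : 0 < 1 + INR j * x) by nra.
    apply Rmult_le_reg_l with ((1 + x) ^ 2 * (1 + INR j * x)); [nra|].
    assert (0 < A + r * (2 + INR j)) by nra.
    apply Rle_trans with ((A + r * (1 + 1 + INR j)) * T); nra.
Qed.

Lemma growth_bound x T r d k :
  0 < x -> 0 < T -> 2 * T <= d -> r * T <= d * x -> 0 <= r ->
  (2 + r * INR k) * T <= d * (1 + x) ^ k.
Proof.
  intros Hx HT H1 H2 Hr. assert (B := poly k x Hx). assert (K := pos_INR k). nra.
Qed.

Lemma Rdiv_lt_1_inv a b : 0 < b -> a / b < 1 -> a < b.
Proof. intros H L. replace a with (a / b * b) by (field; lra). nra. Qed.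

Lemma sqr_gt_1 s : 1 < s -> 1 < s * s.
Proof. nra. Qed.

Lemma even_margin s1 S0 S1 e : 1 < s1 -> s1 < S1 -> 1 < S0 -> 1 / 2 < e ->
  s1 - 1 < (S1 * S1 - 1) * (S0 * S0) * (S1 * e).
Proof.
  intros H1 H2 H3 H4. assert (V1 : 1 < S0 * S0) by nra.
  assert (V2 : 2 * (s1 - 1) <= S1 * S1 - 1) by nra. assert (V3 : 1 / 2 < S1 * e) by nra.
  assert (V4 : S1 * S1 - 1 < (S1 * S1 - 1) * (S0 * S0)) by nra. nra.
Qed.

(** At even levels [g + 1 = 2 * h], so that [r] can be any upper bound of
    [2 * h / g]: 2 at level 0 and 6/5 later. As [2 * T > 1], short runs cause a
    loss [delta = 2 * T - 1], which is outweighed by the increase of [tau]. *)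
Lemma even_run_even_level h g beta eta :
  level false h g -> 1 < beta < eta ->
  let s0 := beta ^ h in let s1 := beta ^ g in
  let S0 := eta ^ h in let S1 := eta ^ g in
  let T := tau false beta in
  0 < 1 - s1 * T -> (1 - s1 * T) * (s0 * s0 * s0 * s0) <= T ->
  exists r delta, 0 <= r /\ 0 <= delta /\
    1 - (s0 * s0) / (S0 * S0) <= r * (1 - s1 / S1) /\
    (forall k, (2 + r * INR k) * T <= (1 + delta) * (s0 * s0) ^ k) /\
    (forall k, (1 <= k)%nat -> (s0 * s0) ^ k * (1 - s1 * T) <= T ->
      (1 - s1 / S1) * delta < (S1 * S1 - 1) * (S0 * S0) *
        (S1 * (tau false eta - T) + (1 - s1 / S1) * (S1 * T - (1 + r * INR k) * (1 - s1 * T)))).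
Proof.
  intros L Hbe s0 s1 S0 S1 T Hy1 Hy2.
  destruct (level_slopes _ _ _ beta L ltac:(lra)) as [A0 [A1 A2]].
  destruct (level_slopes _ _ _ eta L ltac:(lra)) as [B0 [B1 B2]].
  fold s0 in A0, A1, A2. fold s1 in A1, A2. fold S0 in B0, B1, B2. fold S1 in B1, B2.
  destruct (tau_bounds false beta ltac:(lra)) as [HT ET]. fold T in HT, ET.
  assert (G := level_spec _ _ _ L). cbn iota in G.
  set (q := beta / eta) in *.
  assert (Eq : beta = q * eta) by (unfold q; field; lra).
  assert (Hq : 0 < q < 1) by nra.
  assert (EQ : s1 / S1 = q ^ g) by (apply pow_div; lra).
  assert (EP : s0 * s0 / (S0 * S0) = q * q ^ g).
  { rewrite A2, B2, Eq, <- EQ. field. split; lra. }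
  rewrite EQ, EP.
  assert (HQ : 0 < q ^ g < 1).
  { split; [apply pow_lt; lra|]. apply Rle_lt_trans with (q ^ 1); [|lra].
    apply pow_le_1_mono; [lra|lia]. }
  set (x := s0 * s0 - 1). assert (Hx : 0 < x) by (unfold x; nra).
  assert (Hs : s0 * s0 = 1 + x) by (unfold x; ring).
  (* the bound on [1 - s1 * T], rewritten with [beta * s1 = 1 + x] *)
  assert (Hx2 : beta * (2 + x) <= (1 + x) * (1 + x)).
  { assert (E1 : (1 - s1 * T) * (beta + 1) = beta - x).
    { transitivity (beta + 1 - s1 * (T * (beta + 1))); [ring|]. rewrite ET. lra. }
    assert (E2 : (1 - s1 * T) * (beta + 1) * ((1 + x) * (1 + x)) <= beta).
    { replace (s0 * s0 * s0 * s0) with ((1 + x) * (1 + x)) in Hy2 by (rewrite <- Hs; ring). nra. }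
    rewrite E1 in E2. assert (x * (beta * (2 + x)) <= x * ((1 + x) * (1 + x))) by nra.
    apply Rmult_le_reg_l with x; lra. }
  assert (HY : T * (beta + 1) * (2 + x) <= (1 + x) * (1 + x)) by (rewrite ET; lra).
  assert (Hr : exists r, 0 < r /\ 1 - q * q ^ g <= r * (1 - q ^ g) /\ r <= 2 * x /\
    (2 + 2 * r) * T <= (1 + x) ^ 2).
  { replace ((1 + x) ^ 2) with ((1 + x) * (1 + x)) by ring.
    assert (C := level_cases _ _ _ L). cbn iota in C. destruct C as [[Eh Eg]|Hg].
    - exists 2. rewrite Eg in *. simpl pow in *.
      assert (E : 1 + x = beta * beta) by (unfold x, s0; rewrite Eh; ring).
      assert (C1 : 1 + beta * beta <= beta * (beta * beta)).
      { apply Rmult_le_reg_l with beta; [lra|]. nra. }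
      assert (C2 : 2 <= beta * beta) by (clear - C1 Hbe; nra).
      split; [lra|]. split; [nra|]. split; [lra|].
      assert (D1 : 6 <= (beta + 1) * (2 + x)) by (clear - C2 E Hbe; nra).
      assert (0 < T) by lra. nra.
    - exists (6 / 5). assert (C1 : 1 <= x * x + x) by nra. assert (C2 : 3 / 5 <= x) by nra.
      split; [lra|]. split; [|split; [lra|]].
      + assert (D := pow_le_1_mono q 5 g Hq Hg).
        assert (D2 : 5 * q ^ 5 * (1 - q) <= 1 - q ^ 5).
        { assert (P : forall m, (m <= 5)%nat -> q ^ 5 <= q ^ m) by (intros; now apply pow_le_1_mono).
          assert (P1 := P 1%nat ltac:(lia)). assert (P2 := P 2%nat ltac:(lia)).
          assert (P3 := P 3%nat ltac:(lia)). assert (P4 := P 4%nat ltac:(lia)).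
          assert (P5 : q ^ 5 <= 1) by (apply (P 0%nat); lia).
          replace (1 - q ^ 5) with ((1 - q) * (1 + q ^ 1 + q ^ 2 + q ^ 3 + q ^ 4)) by ring.
          rewrite (Rmult_comm (5 * q ^ 5)). apply Rmult_le_compat_l; lra. }
        assert (q ^ g * (1 - q) <= q ^ 5 * (1 - q)) by (apply Rmult_le_compat_r; lra). lra.
      + assert (D1 : 22 / 5 <= (beta + 1) * (2 + x)) by nra. nra. }
  destruct Hr as [r [Hr0 [Hr1 [Hr2 Hr3]]]].
  exists r, (2 * T - 1).
  assert (Hd : 0 < 2 * T - 1) by (clear - ET HT Hbe; nra).
  split; [lra|]. split; [lra|]. split; [exact Hr1|]. rewrite Hs. split.
  - intros k. replace (1 + (2 * T - 1)) with (2 * T) by ring. apply growth_bound; nra.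
  - intros k Hk Hkx.
    assert (Y2 : (1 + x) ^ 2 * (1 - s1 * T) <= T).
    { replace (s0 * s0 * s0 * s0) with ((1 + x) ^ 2) in Hy2 by (simpl; rewrite <- Hs; ring). lra. }
    assert (HB : (2 + r * INR k) * (1 - s1 * T) <= 1).
    { apply (run_length_bound x (1 - s1 * T) T r 2 1 k); try lra; try easy.
      set (X2 := (1 + x) ^ 2) in *. clear - Hr3 Hr2 Hr0 HT Hx.
      assert (2 * T <= X2) by nra. assert (r * T <= 2 * x * T) by nra. nra. }
    assert (SS : s1 < S1).
    { apply Rdiv_lt_1_inv; lra. }
    assert (Br : 0 <= (1 - q ^ g) * (S1 * T - (1 + r * INR k) * (1 - s1 * T))).
    { apply Rmult_le_pos; [lra|]. assert (s1 * T <= S1 * T) by nra. lra. }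
    assert (I : 0 < / (beta + 1)) by (apply Rinv_0_lt_compat; lra).
    assert (E0 : tau false eta - T = (1 - q) * (eta / (eta + 1)) * / (beta + 1)).
    { unfold T, tau, q. field. lra. }
    assert (Ed : 2 * T - 1 = (beta - 1) * / (beta + 1)) by (unfold T, tau; field; lra).
    assert (GC := geometric_compare q beta g Hq ltac:(lra)). fold s1 in GC.
    assert (Hee : 1 / 2 < eta / (eta + 1)).
    { apply Rmult_lt_reg_r with (eta + 1); [lra|]. unfold Rdiv at 2. rewrite Rmult_assoc, Rinv_l; lra. }
    rewrite E0, Ed. set (e := eta / (eta + 1)) in *. set (i := / (beta + 1)) in *.
    assert (U1 : (1 - q ^ g) * ((beta - 1) * i) <= (1 - q) * (s1 - 1) * i) by nra.
    assert (U2 : (1 - q) * i * (s1 - 1) < (1 - q) * i * ((S1 * S1 - 1) * (S0 * S0) * (S1 * e))).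
    { apply Rmult_lt_compat_l; [apply Rmult_lt_0_compat; lra|]. apply even_margin; lra. }
    assert (U3 : 0 <= (S1 * S1 - 1) * (S0 * S0)) by (apply Rmult_le_pos; [assert (Q1 := sqr_gt_1 S1 ltac:(lra))|assert (Q1 := sqr_gt_1 S0 B0)]; lra).
    assert (U4 := Rmult_le_pos _ _ U3 Br). lra.
Qed.

(** The numbers 119/100 and 53/40 approximate the roots of [b ^ 5 = b ^ 2 + 1] and
    [b ^ 3 = b + 1]: both bases are confined to a short interval. *)
Lemma odd_level_3_margins beta eta q T :
  1 < beta < eta -> beta = q * eta -> 0 < q < 1 -> 0 < T -> T * (beta + 1) = 1 ->
  eta * eta * eta < eta + 1 -> 1 + beta * beta <= beta * (beta * beta * (beta * beta)) ->
  1 + q <= 71 / 100 * (1 + q + q * q) /\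
  71 / 100 * T <= beta * beta - 1 /\
  eta <= 22 / 100 * (eta + 1) * (1 + q + q * q) /\
  1 + 2 * (71 / 100) < (1 - 22 / 100) * (beta * beta * beta) * (beta * beta * (beta * beta)) /\
  71 / 100 < (1 - 22 / 100) * (beta * beta * beta) * (beta * beta * (beta * beta)) * (beta * beta - 1).
Proof.
  intros Hb Eq Hq HT ET He Hx.
  assert (F1 : eta < 53 / 40).
  { clear - Hb He. apply Rnot_le_lt. intros F. assert (7 / 4 <= eta * eta) by nra. nra. }
  assert (F2 : 119 / 100 < beta).
  { clear - Hb Hx. apply Rnot_le_lt. intros F.
    assert (W : beta * beta <= 14161 / 10000) by nra.
    assert (W1 : 1 < beta * beta) by nra.
    set (w := beta * beta) in *.
    assert (V : beta * (w * w) <= 119 / 100 * (w * w)).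
    { apply Rmult_le_compat_r; [|lra]. apply Rmult_le_pos; lra. }
    assert (0 <= (w - 1) * (14161 / 10000 - w)) by (apply Rmult_le_pos; lra). nra. }
  assert (F3 : 89 / 100 < q) by (clear - F1 F2 Eq Hq Hb; nra).
  assert (F4 : 14161 / 10000 < beta * beta) by (clear - F2; nra).
  assert (F5 : 2 < beta * beta * (beta * beta)) by (clear - F4; nra).
  assert (F7 : 1685 / 1000 < beta * beta * beta) by (clear - F2 F4; nra).
  assert (F6 : 337 / 100 < beta * beta * beta * (beta * beta * (beta * beta)))
    by (clear - F5 F7; nra).
  assert (F8 : 79 / 100 < q * q) by (clear - F3; nra).
  split; [clear - F3 Hq; nra|]. split; [|split; [|split; [lra|]]].
  - clear - F4 ET HT Hb. nra.
  - clear - F8 F3 F1 Hb. nra.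
  - rewrite (Rmult_assoc (1 - 22 / 100)).
    set (P := beta * beta * beta * (beta * beta * (beta * beta))) in *. clear - F6 F4. nra.
Qed.

(** Since [beta] is close to 1, the last hypothesis makes [x] at least 1/2. *)
Lemma odd_level_later_margins beta eta q T x :
  1 < beta < eta -> beta = q * eta -> 0 < q < 1 -> 0 < T -> T * (beta + 1) = 1 ->
  eta < 11 / 10 -> 0 < x -> 2 + x <= beta * ((1 + x) * (1 + x)) ->
  1 * T <= x /\
  eta <= 13 / 100 * (eta + 1) * (1 + q + q * q + q * q * q + q * q * q * q) /\
  1 + 2 * 1 < (1 - 13 / 100) * (beta * (1 + x)) * ((1 + x) * (1 + x)) /\
  1 < (1 - 13 / 100) * (beta * (1 + x)) * ((1 + x) * (1 + x)) * x.
Proof.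
  intros Hb Eq Hq HT ET He Hx0 Hx.
  assert (F2 : 1 / 2 <= x) by (clear - Hb He Hx0 Hx; nra).
  assert (F3 : 9 / 10 < q) by (clear - Hb He Eq Hq; nra).
  assert (F6 : 15 / 4 <= beta * (1 + x) * ((1 + x) * (1 + x))).
  { replace (beta * (1 + x) * ((1 + x) * (1 + x))) with (beta * ((1 + x) * (1 + x)) * (1 + x)) by ring.
    assert (5 / 2 * (3 / 2) <= (2 + x) * (1 + x)) by (clear - F2; nra).
    assert ((2 + x) * (1 + x) <= beta * ((1 + x) * (1 + x)) * (1 + x))
      by (apply Rmult_le_compat_r; lra). lra. }
  assert (D1 : 81 / 100 <= q * q) by (clear - F3; nra).
  assert (D2 : 72 / 100 <= q * q * q) by (clear - F3 D1; nra).
  assert (D3 : 64 / 100 <= q * q * q * q) by (clear - F3 D2; nra).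
  rewrite !(Rmult_assoc (1 - 13 / 100)).
  set (P := beta * (1 + x) * ((1 + x) * (1 + x))) in *.
  split; [clear - ET HT F2 Hb; nra|]. split; [clear - D1 D2 D3 F3 He Hb; nra|].
  split; [lra|]. clear - F6 F2. nra.
Qed.

(** At odd levels [g = 2 * h + 1] and [2 * T < 1], so that [delta = 0]; the loss
    comes from the decrease of [tau] and is a fraction [c] of the first gain. The
    level with [g = 3] needs sharper constants than the later ones. *)
Lemma even_run_odd_level h g beta eta :
  level true h g -> 1 < beta < eta ->
  let s0 := beta ^ h in let s1 := beta ^ g in
  let S0 := eta ^ h in let S1 := eta ^ g in
  let T := tau true beta in
  0 < 1 - s1 * T -> (1 - s1 * T) * (s0 * s0 * s0 * s0) <= T ->
  0 < 1 - S1 * tau true eta ->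
  exists r delta, 0 <= r /\ 0 <= delta /\
    1 - (s0 * s0) / (S0 * S0) <= r * (1 - s1 / S1) /\
    (forall k, (2 + r * INR k) * T <= (1 + delta) * (s0 * s0) ^ k) /\
    (forall k, (1 <= k)%nat -> (s0 * s0) ^ k * (1 - s1 * T) <= T ->
      (1 - s1 / S1) * delta < (S1 * S1 - 1) * (S0 * S0) *
        (S1 * (tau true eta - T) + (1 - s1 / S1) * (S1 * T - (1 + r * INR k) * (1 - s1 * T)))).
Proof.
  intros L Hbe s0 s1 S0 S1 T Hy1 Hy2 Hz1.
  destruct (level_slopes _ _ _ beta L ltac:(lra)) as [A0 [A1 A2]].
  destruct (level_slopes _ _ _ eta L ltac:(lra)) as [B0 [B1 B2]].
  fold s0 in A0, A1, A2. fold s1 in A1, A2. fold S0 in B0, B1, B2. fold S1 in B1, B2.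
  destruct (tau_bounds true beta ltac:(lra)) as [HT ET]. fold T in HT, ET.
  destruct (tau_bounds true eta ltac:(lra)) as [_ ET'].
  assert (G := level_spec _ _ _ L). cbn iota in G.
  set (q := beta / eta) in *.
  assert (Eq : beta = q * eta) by (unfold q; field; lra).
  assert (Hq : 0 < q < 1) by nra.
  assert (EQ : s1 / S1 = q ^ g) by (apply pow_div; lra).
  assert (EP : s0 * s0 / (S0 * S0) = q ^ (2 * h)).
  { unfold q. rewrite <- pow_div by lra. unfold s0, S0. rewrite <- !pow_add. f_equal; f_equal; lia. }
  rewrite EQ, EP.
  assert (HQ : 0 < q ^ g < 1).
  { split; [apply pow_lt; lra|]. apply Rle_lt_trans with (q ^ 1); [|lra].
    apply pow_le_1_mono; [lra|lia]. }
  set (x := s0 * s0 - 1). assert (Hx : 0 < x) by (unfold x; nra).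
  assert (Hs : s0 * s0 = 1 + x) by (unfold x; ring). rewrite Hs in A2.
  (* the bound on [1 - s1 * T], rewritten with [s1 = beta * (1 + x)] *)
  assert (Hx2 : 2 + x <= beta * ((1 + x) * (1 + x))).
  { assert (E1 : (1 - s1 * T) * (beta + 1) = 1 - beta * x).
    { transitivity (beta + 1 - s1 * (T * (beta + 1))); [ring|]. rewrite ET, A2. ring. }
    assert (E2 : (1 - s1 * T) * (beta + 1) * ((1 + x) * (1 + x)) <= 1).
    { replace (s0 * s0 * s0 * s0) with ((1 + x) * (1 + x)) in Hy2 by (rewrite <- Hs; ring). nra. }
    rewrite E1 in E2. assert (x * (2 + x) <= x * (beta * ((1 + x) * (1 + x)))) by nra.
    apply Rmult_le_reg_l with x; lra. }
  assert (Hz2 : S1 < eta + 1) by nra.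
  assert (Hr : exists r c m, 0 < r /\ 1 - q ^ (2 * h) <= r * (1 - q ^ g) /\ r * T <= x /\
    (m <= g)%nat /\ 0 <= c < 1 /\ eta * (1 - q) <= c * (eta + 1) * (1 - q ^ m) /\
    1 + 2 * r < (1 - c) * s1 * (1 + x) ^ 2 /\ r < (1 - c) * s1 * (1 + x) ^ 2 * x).
  { replace ((1 + x) ^ 2) with ((1 + x) * (1 + x)) by ring.
    assert (C := level_cases _ _ _ L). cbn iota in C. destruct C as [[Eh Eg]|Hg].
    - exists (71 / 100), (22 / 100), 3%nat.
      assert (E : 1 + x = beta * beta) by (unfold x, s0; rewrite Eh; ring).
      assert (E1 : s1 = beta * beta * beta) by (unfold s1; rewrite Eg; ring).
      assert (E2 : S1 = eta * eta * eta) by (unfold S1; rewrite Eg; ring).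
      rewrite Eg, Eh. change (2 * 1)%nat with 2%nat. rewrite geometric_factor_3.
      replace (1 - q ^ 2) with ((1 - q) * (1 + q)) by ring.
      destruct (odd_level_3_margins beta eta q T) as [M1 [M2 [M3 [M4 M5]]]]; trivial; try lra.
      { rewrite E in Hx2. lra. }
      rewrite E1, E. replace x with (beta * beta - 1) by lra.
      split; [lra|]. split; [|split; [lra|split; [lia|split; [lra|split; [|lra]]]]].
      + rewrite (Rmult_comm (1 - q)), (Rmult_comm (1 - q)), <- Rmult_assoc.
        apply Rmult_le_compat_r; lra.
      + rewrite (Rmult_comm (1 - q)), <- !Rmult_assoc. apply Rmult_le_compat_r; lra.
    - exists 1, (13 / 100), 5%nat.
      assert (F1 : eta < 11 / 10).
      { apply Rnot_le_lt. intros F.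
        assert (F2 : eta ^ 11 <= S1) by (apply Rle_pow; [lra|easy]).
        assert (F3 : (11 / 10) ^ 10 <= eta ^ 10) by (apply pow_incr; lra).
        change (eta ^ 11) with (eta * eta ^ 10) in F2.
        assert (2 < (11 / 10) ^ 10) by (simpl; lra). nra. }
      destruct (odd_level_later_margins beta eta q T x) as [M1 [M2 [M3 M4]]]; trivial; try lra.
      rewrite A2.
      split; [lra|]. split; [|split; [lra|split; [lia|split; [lra|split; [|lra]]]]].
      + assert (D := pow_le_1_mono q (2 * h) g Hq ltac:(lia)). lra.
      + replace (1 - q ^ 5) with ((1 + q + q * q + q * q * q + q * q * q * q) * (1 - q)) by ring.
        rewrite <- !Rmult_assoc. apply Rmult_le_compat_r; lra. }
  destruct Hr as [r [c [m [Hr0 [Hr1 [Hr2 [Hm [Hc [Hc1 [Hr3 Hr4]]]]]]]]]].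
  exists r, 0. split; [lra|]. split; [lra|]. split; [exact Hr1|]. rewrite Hs. split.
  - intros k. rewrite Rplus_0_r. assert (2 * T <= 1) by (clear - ET HT Hbe; nra).
    apply growth_bound; lra.
  - intros k Hk Hkx. rewrite Rmult_0_r.
    assert (Y2 : (1 + x) ^ 2 * (1 - s1 * T) <= T).
    { replace (s0 * s0 * s0 * s0) with ((1 + x) ^ 2) in Hy2 by (simpl; rewrite <- Hs; ring). lra. }
    assert (HB : (1 + r * INR k) * (1 - s1 * T) <= (1 - c) * s1 * T).
    { apply (run_length_bound x (1 - s1 * T) T r 1 _ k); try lra; try easy.
      - replace ((1 - c) * s1 * T * (1 + x) ^ 2) with ((1 - c) * s1 * (1 + x) ^ 2 * T) by ring. nra.
      - replace ((1 - c) * s1 * T * (1 + x) ^ 2 * x) with ((1 - c) * s1 * (1 + x) ^ 2 * x * T) by ring. nra. }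
    assert (SS : s1 < S1).
    { apply Rdiv_lt_1_inv; lra. }
    assert (D := tau_true_decrease beta eta g m c Hbe Hm Hc1 ltac:(lra)).
    fold T s1 S1 in D. rewrite EQ in D.
    assert (U1 : (1 - c) * s1 * T < (1 - c) * S1 * T).
    { apply Rmult_lt_compat_r; [lra|]. apply Rmult_lt_compat_l; lra. }
    assert (U2 : 0 < (1 - q ^ g) * ((1 - c) * S1 * T - (1 + r * INR k) * (1 - s1 * T))).
    { apply Rmult_lt_0_compat; lra. }
    assert (Q0 := sqr_gt_1 S0 B0). assert (Q1 := sqr_gt_1 S1 ltac:(lra)).
    apply Rmult_lt_0_compat; [apply Rmult_lt_0_compat; lra|].
    assert (S1 * (- c * (T * (1 - q ^ g))) <= S1 * (tau true eta - T)).
    { apply Rmult_le_compat_l; lra. }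
    lra.
Qed.

(** * Uniqueness of the base *)

Lemma pow_lt_base beta eta g : 0 < beta < eta -> (1 <= g)%nat -> beta ^ g < eta ^ g.
Proof.
  intros Hb. induction 1 as [|g _ IH]; [lra|]. simpl.
  assert (0 < beta ^ g) by (apply pow_lt; lra). nra.
Qed.

(** The run of letters 0 after the first letter 1 is even, so that [z] must be
    positive at its beginning too; this bounds [eta] from above. *)
Lemma even_run_unique p h g beta eta b y z :
  level p h g -> 1 < beta < eta ->
  level_orbit p h g beta b y -> level_orbit p h g eta b z ->
  y 0%nat = tau p beta -> z 0%nat = tau p eta ->
  0 < 1 - beta ^ g * tau p beta ->
  (1 - beta ^ g * tau p beta) * (beta ^ h * beta ^ h * beta ^ h * beta ^ h) <= tau p beta ->
  False.
Proof.
  intros L Hbe Hy Hz Hy0 Hz0 H1 H2.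
  destruct (level_starts_10 p h g beta b y L) as [E0 E1]; trivial; try lra.
  destruct (level_slopes _ _ _ beta L) as [A0 [A1 A2]]; [lra|].
  destruct (level_slopes _ _ _ eta L) as [B0 [B1 B2]]; [lra|].
  destruct (level_spec _ _ _ L) as [G _].
  destruct (tau_bounds p beta) as [HT _]; [lra|].
  destruct (tau_bounds p eta) as [HT' _]; [lra|].
  destruct Hy as [Hy HyT]. destruct Hz as [Hz HzT].
  assert (C0 : beta ^ h <= eta ^ h) by (apply pow_incr; lra).
  assert (C1 : beta ^ g < eta ^ g) by (apply pow_lt_base; [lra|lia]).
  assert (C2 := pow_cross beta eta h g ltac:(lra) ltac:(lia)).
  assert (Z1 : 0 < 1 - eta ^ g * tau p eta).
  { destruct (pair_next_one (beta ^ h) (beta ^ g) (tau p beta) (eta ^ h) (eta ^ g)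
      (tau p eta) b y z A0 A1 HT HT' Hy Hz HyT H1 0 E0) as [k [Ek [_ Zk]]].
    assert (Pk := skew_pos (eta ^ h) (eta ^ g) (tau p eta) b z ltac:(lra) HT' Hz HzT _ Ek).
    rewrite Zk, (skew_true _ _ _ _ Hz _ E0), Hz0 in Pk.
    assert (0 < (eta ^ h * eta ^ h) ^ k) by (apply pow_lt; nra). nra. }
  assert (N : exists r delta, 0 <= r /\ 0 <= delta /\
    1 - (beta ^ h * beta ^ h) / (eta ^ h * eta ^ h) <= r * (1 - beta ^ g / eta ^ g) /\
    (forall k, (2 + r * INR k) * tau p beta <= (1 + delta) * (beta ^ h * beta ^ h) ^ k) /\
    (forall k, (1 <= k)%nat ->
      (beta ^ h * beta ^ h) ^ k * (1 - beta ^ g * tau p beta) <= tau p beta ->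
      (1 - beta ^ g / eta ^ g) * delta < (eta ^ g * eta ^ g - 1) * (eta ^ h * eta ^ h) *
        (eta ^ g * (tau p eta - tau p beta) + (1 - beta ^ g / eta ^ g) *
          (eta ^ g * tau p beta - (1 + r * INR k) * (1 - beta ^ g * tau p beta))))).
  { destruct p; [apply even_run_odd_level|apply even_run_even_level]; easy. }
  destruct N as [r [delta [N1 [N2 [N3 [N4 N5]]]]]].
  apply (pair_even_run (beta ^ h) (beta ^ g) (tau p beta) (eta ^ h) (eta ^ g) (tau p eta)
    b y z) with r delta; trivial.
  intros k Hk Hx. rewrite Hz0. now apply N5.
Qed.

Lemma odd_run_unique p h g beta eta b y z :
  level p h g -> 1 < beta < eta -> eta * eta <= eta + 1 ->
  level_orbit p h g beta b y -> level_orbit p h g eta b z ->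
  y 0%nat = tau p beta -> z 0%nat = tau p eta ->
  1 - beta ^ g * tau p beta <= 0 -> False.
Proof.
  intros L Hbe Hgold Hy Hz Hy0 Hz0 H1.
  destruct (level_starts_10 p h g beta b y L) as [E0 _]; trivial; try lra.
  destruct (level_slopes _ _ _ beta L) as [A0 [A1 A2]]; [lra|].
  destruct (level_slopes _ _ _ eta L) as [B0 [B1 B2]]; [lra|].
  destruct (level_spec _ _ _ L) as [G G'].
  destruct (tau_bounds p beta) as [HT ET]; [lra|].
  destruct (tau_bounds p eta) as [HT' _]; [lra|].
  destruct Hy as [Hy HyT]. destruct Hz as [Hz HzT].
  assert (C0 : beta ^ h <= eta ^ h) by (apply pow_incr; lra).
  assert (C1 : beta ^ g < eta ^ g) by (apply pow_lt_base; [lra|lia]).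
  assert (C2 := pow_cross beta eta h g ltac:(lra) ltac:(lia)).
  apply (pair_odd_run (beta ^ h) (beta ^ g) (tau p beta) (eta ^ h) (eta ^ g) (tau p eta)
    b y z) with (if p then 69 / 100 else 1); trivial; try (destruct p; lra); rewrite ?Hz0.
  - destruct p.
    + apply Rge_trans with (- (31 / 100) * (tau true beta * (1 - beta ^ g / eta ^ g))); [|lra].
      apply tau_true_decrease with 3%nat; trivial; [lia| |lra].
      (* [q > 1 / eta], and [1 + v + v ^ 2 >= 2] for [v = 1 / eta], because [eta] is
         at most the golden mean. *)
      rewrite geometric_factor_3. set (q := beta / eta).
      assert (Eq : q * eta = beta) by (unfold q; field; lra).
      assert (Hq : 0 < q < 1) by (clear - Eq Hbe; nra).
      assert (F1 : eta <= 81 / 50) by (clear - Hgold Hbe; nra).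
      assert (F2 : 2 <= 1 + q + q * q).
      { apply Rmult_le_reg_l with (eta * eta); [clear - Hbe; nra|].
        replace (eta * eta * (1 + q + q * q)) with (eta * eta + eta * (q * eta) + (q * eta) * (q * eta)) by ring.
        rewrite Eq. clear - Hbe Hgold. nra. }
      assert (F3 : eta <= 31 / 100 * (eta + 1) * (1 + q + q * q)) by (clear - F1 F2 Hbe; nra).
      rewrite (Rmult_comm (1 - q)), <- !Rmult_assoc. apply Rmult_le_compat_r; lra.
    + unfold tau. assert (0 <= eta / (eta + 1) - beta / (beta + 1)); [|lra].
      replace (eta / (eta + 1) - beta / (beta + 1))
        with ((eta - beta) * / ((eta + 1) * (beta + 1))) by (field; lra).
      apply Rmult_le_pos; [lra|]. apply Rlt_le, Rinv_0_lt_compat. nra.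
  - destruct p.
    + apply (odd_run_odd_level beta (beta ^ h) (beta ^ g) (tau true beta)); trivial; lra.
    + apply (odd_run_even_level beta (beta ^ h) (beta ^ g) (tau false beta)); trivial; lra.
Qed.

(** If neither estimate applies, [skew_blocks] allows a desubstitution. Then
    [beta ^ g < beta + 1], so that [N - g] bounds the number of further levels. *)
Lemma level_unique N m p h g beta eta b y z :
  level p h g -> 1 < beta < eta -> eta * eta <= eta + 1 -> beta + 1 < beta ^ N ->
  (N - g < m)%nat ->
  level_orbit p h g beta b y -> level_orbit p h g eta b z ->
  y 0%nat = tau p beta -> z 0%nat = tau p eta -> False.
Proof.
  revert p h g b y z. induction m as [|m IH]; [lia|].
  intros p h g b y z L Hbe Hgold HN Hm Hy Hz Hy0 Hz0.
  destruct (Rle_lt_dec (1 - beta ^ g * tau p beta) 0) as [H1|H1].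
  { exact (odd_run_unique _ _ _ _ _ _ _ _ L Hbe Hgold Hy Hz Hy0 Hz0 H1). }
  destruct (Rle_lt_dec ((1 - beta ^ g * tau p beta) * (beta ^ h * beta ^ h * beta ^ h * beta ^ h))
    (tau p beta)) as [H2|H2].
  { exact (even_run_unique _ _ _ _ _ _ _ _ L Hbe Hy Hz Hy0 Hz0 H1 H2). }
  destruct (level_starts_10 p h g beta b y L) as [E0 _]; trivial; try lra.
  destruct (level_slopes _ _ _ beta L) as [A0 [A1 A2]]; [lra|].
  destruct (tau_bounds p beta) as [HT ET]; [lra|].
  destruct (desubst_exists b E0) as [b' [pos D]].
  { destruct Hy as [Hy HyT]. apply (skew_blocks (beta ^ h) (beta ^ g) (tau p beta) b y); trivial; lra. }
  assert (He : 1 < eta) by lra.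
  destruct (level_orbit_desubst _ _ _ _ _ _ _ _ L (proj1 Hbe) Hy D) as [y' [Hy' Hy0']].
  destruct (level_orbit_desubst _ _ _ _ _ _ _ _ L He Hz D) as [z' [Hz' Hz0']].
  apply (IH _ _ _ b' y' z' (level_S _ _ _ L)); auto.
  assert (g < N)%nat.
  { destruct (le_lt_dec N g) as [F|F]; [|easy]. exfalso.
    assert (beta ^ N <= beta ^ g) by (apply Rle_pow; [lra|easy]).
    assert (F2 : beta ^ g * (tau p beta * (beta + 1)) < beta + 1).
    { rewrite <- Rmult_assoc. rewrite <- (Rmult_1_l (beta + 1)) at 2.
      apply Rmult_lt_compat_r; lra. }
    rewrite ET in F2. set (s1 := beta ^ g) in *. clear - F2 HN H A0 A1 Hbe.
    destruct p; nra. }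
  destruct (level_spec _ _ _ L) as [G _]. lia.
Qed.

(** A digit [a n] is at most [beta], because [t (S n)] and [t n] are at most 1. *)
Lemma expands_one_bits beta a t :
  beta * beta <= beta + 1 -> 1 < beta -> (forall n, (0 <= a n)%Z) ->
  orbit beta a t -> (forall k, 0 <= t k <= 1) ->
  forall n, a n = Z.b2z (a n =? 1)%Z.
Proof.
  intros Hg Hb Ha Ho Ht n.
  assert (E := Ho n). assert (A := Ht n). assert (B := Ht (S n)).
  assert (L : IZR (a n) < 2) by nra. apply lt_IZR in L. specialize (Ha n).
  destruct (Z.eqb_spec (a n) 1); simpl; lia.
Qed.

Lemma expands_one_unique_lt beta eta a t w :
  (forall n, (0 <= a n)%Z) -> 1 < beta < eta ->
  expands_one beta a t -> expands_one eta a w -> False.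
Proof.
  intros Ha Hbe Ht Hw.
  destruct (Rlt_le_dec (eta + 1) (eta * eta)) as [G|G].
  { exact (golden_unique _ _ _ _ _ Hbe G Ht Hw). }
  destruct Ht as [Ho [H0 Ht]]. destruct Hw as [Ho' [H0' Hw]].
  set (b := fun n => (a n =? 1)%Z).
  assert (Hb : forall n, a n = Z.b2z (b n)).
  { apply (expands_one_bits eta a w); trivial; lra. }
  destruct (pow_unbounded beta (beta + 1) 1) as [N HN]; [lra|lra|].
  apply (level_unique N (S (N - 1)) false 1 1 beta eta b
    (fun k => t k - 1 / (beta + 1)) (fun k => w k - 1 / (eta + 1)) level_0); trivial; try lra; try lia.
  - apply level_orbit_0 with a; trivial; [lra|]. intros k. apply Ht.
  - apply level_orbit_0 with a; trivial; [lra|]. intros k. apply Hw.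
  - rewrite H0. unfold tau. field. lra.
  - rewrite H0'. unfold tau. field. lra.
Qed.

Lemma expands_one_unique beta eta a t w :
  (forall n, (0 <= a n)%Z) -> 1 < beta -> 1 < eta ->
  expands_one beta a t -> expands_one eta a w -> beta = eta.
Proof.
  intros Ha Hb He Ht Hw. destruct (Rtotal_order beta eta) as [L|[L|L]]; [|easy|];
    exfalso; eapply expands_one_unique_lt; eauto.
Qed.

(** * Desubstitution and the sequence u *)

Definition bits (b : nat -> bool) (n : nat) : Z := Z.b2z (b n).

Lemma bits_inj b c n : bits b n = bits c n -> b n = c n.
Proof. unfold bits. now destruct (b n), (c n). Qed.

Lemma desubst_pos_ge b b' pos : desubst b b' pos -> forall j, (j <= pos j)%nat.
Proof.
  intros [H0 H] j. induction j as [|j IH]; [lia|].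
  destruct (H j) as [_ A]. destruct (b' j); lia.
Qed.

Lemma desubst_pos_even b b' pos : desubst b b' pos ->
  forall j, Nat.even (pos j) = Nat.even j.
Proof.
  intros [H0 H] j. induction j as [|j IH]; [now rewrite H0|].
  destruct (H j) as [_ A].
  assert (E : Nat.even (pos (S j)) = negb (Nat.even (pos j))).
  { destruct (b' j).
    - destruct A as [_ [_ A]]. rewrite A, Nat.even_add. now destruct (Nat.even (pos j)).
    - rewrite A, Nat.even_add. now destruct (Nat.even (pos j)). }
  rewrite E, IH. symmetry. apply even_S_negb.
Qed.

Lemma desubst_agree b b' pos c c' pos' i :
  desubst b b' pos -> desubst c c' pos' -> (forall j, (j < i)%nat -> b' j = c' j) ->
  pos i = pos' i /\ forall n, (n < pos i)%nat -> b n = c n.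
Proof.
  intros [H0 H] [H0' H'] E. induction i as [|i IH].
  - rewrite H0, H0'. split; [easy|lia].
  - destruct IH as [P A]; [intros; apply E; lia|].
    destruct (H i) as [B0 B1]. destruct (H' i) as [C0 C1].
    rewrite <- (E i ltac:(lia)), <- P in C1. rewrite <- P in C0.
    destruct (b' i).
    + destruct B1 as [B1 [B2 B3]]. destruct C1 as [C1 [C2 C3]]. split; [lia|].
      intros n Hn. destruct (lt_dec n (pos i)) as [L|L]; [now apply A|].
      assert (D : n = pos i \/ n = (pos i + 1)%nat \/ n = (pos i + 2)%nat) by lia.
      destruct D as [D|[D|D]]; subst n; congruence.
    + split; [lia|]. intros n Hn. destruct (lt_dec n (pos i)) as [L|L]; [now apply A|].
      assert (D : n = pos i) by lia. subst n. congruence.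
Qed.

(** Blocks have odd lengths, so that parities of positions are kept; 100 and 1
    first differ at the second letter of 100, where the next block after 1
    begins with 1. *)
Lemma desubst_first_diff b b' pos c c' pos' i :
  desubst b b' pos -> desubst c c' pos' ->
  first_diff i (bits b') (bits c') -> first_diff (pos i + 1) (bits b) (bits c).
Proof.
  intros D D' [E F].
  destruct (desubst_agree b b' pos c c' pos' i D D') as [P A].
  { intros j Hj. apply bits_inj. now apply E. }
  destruct D as [D0 D]. destruct D' as [D0' D'].
  assert (Ev := desubst_pos_even b b' pos (conj D0 D) i).
  destruct (D i) as [B0 B1]. destruct (D' i) as [C0 C1]. rewrite <- P in C0, C1.
  split.
  - intros n Hn. unfold bits. f_equal. destruct (lt_dec n (pos i)) as [L|L]; [now apply A|].
    replace n with (pos i) by lia. congruence.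
  - rewrite Nat.add_1_r, even_S_negb, Ev. rewrite <- Nat.add_1_r.
    destruct (D (S i)) as [B2 _]. destruct (D' (S i)) as [C2 _].
    unfold bits in *. destruct (Nat.even i); simpl;
      destruct (b' i), (c' i); simpl in F; try lia.
    + destruct C1 as [C1 _]. rewrite B1 in B2. rewrite B2, C1. easy.
    + destruct B1 as [B1 _]. rewrite C1 in C2. rewrite C2, B1. easy.
Qed.

Lemma desubst_seq_eq b b' pos c c' pos' :
  desubst b b' pos -> desubst c c' pos' ->
  seq_eq (bits b') (bits c') -> seq_eq (bits b) (bits c).
Proof.
  intros D D' E n. unfold bits. f_equal.
  destruct (desubst_agree b b' pos c c' pos' (S n) D D') as [_ A].
  { intros j _. apply bits_inj, E. }
  apply A. apply (desubst_pos_ge _ _ _ D).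
Qed.

Lemma desubst_le b b' pos c c' pos' :
  desubst b b' pos -> desubst c c' pos' ->
  le_alt (bits b') (bits c') -> le_alt (bits b) (bits c).
Proof.
  intros D D' [[i H]|H].
  - left. eexists. exact (desubst_first_diff _ _ _ _ _ _ _ D D' H).
  - right. exact (desubst_seq_eq _ _ _ _ _ _ D D' H).
Qed.

Lemma first_diff_unique i j x y : first_diff i x y -> first_diff j x y -> i = j.
Proof.
  intros [A B] [C D]. destruct (lt_eq_lt_dec i j) as [[L|L]|L]; [|easy|].
  - specialize (C i L). destruct (Nat.even i); lia.
  - specialize (A j L). destruct (Nat.even j); lia.
Qed.

Lemma desubst_first_diff_inv b b' pos c c' pos' i :
  desubst b b' pos -> desubst c c' pos' -> first_diff i (bits b) (bits c) ->
  exists i', (i' < i)%nat /\ first_diff i' (bits b') (bits c').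
Proof.
  intros D D' H.
  destruct (alt_total (bits b') (bits c')) as [[i' L]|[L|[i' L]]].
  - exists i'. split; [|easy].
    assert (E := first_diff_unique _ _ _ _ H (desubst_first_diff _ _ _ _ _ _ _ D D' L)).
    assert (G := desubst_pos_ge _ _ _ D i'). lia.
  - exfalso. apply (lt_alt_not_le _ _ (ex_intro _ i H)). right. intros n. symmetry.
    now apply (desubst_seq_eq _ _ _ _ _ _ D D').
  - exfalso. exact (first_diff_asym _ _ _ _ H (desubst_first_diff _ _ _ _ _ _ _ D' D L)).
Qed.

(** Only the first letter of a block is 1. *)
Lemma desubst_pos_surj b b' pos n : desubst b b' pos -> b n = true ->
  exists j, pos j = n.
Proof.
  intros D Hn.
  assert (G : forall j, (exists i, pos i = n) \/ (pos j <= n)%nat).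
  { destruct D as [D0 D]. induction j as [|j [IH|IH]]; [right; lia|now left|].
    destruct (Nat.eq_dec (pos j) n) as [E|E]; [left; now exists j|].
    destruct (D j) as [_ A]. right. destruct (b' j); [|lia].
    destruct A as [A1 [A2 A3]].
    destruct (Nat.eq_dec n (pos j + 1)) as [F|F]; [congruence|].
    destruct (Nat.eq_dec n (pos j + 2)) as [F'|F']; [congruence|]. lia. }
  destruct (G (S n)) as [H|H]; [easy|].
  assert (K := desubst_pos_ge _ _ _ D (S n)). lia.
Qed.

Lemma desubst_drop b b' pos j : desubst b b' pos ->
  desubst (fun n => b (pos j + n)%nat) (fun n => b' (j + n)%nat)
    (fun n => (pos (j + n) - pos j)%nat).
Proof.
  intros [D0 D].
  assert (M : forall n, (pos j <= pos (j + n))%nat).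
  { induction n as [|n IH]; [rewrite Nat.add_0_r; lia|].
    rewrite Nat.add_succ_r. destruct (D (j + n)%nat) as [_ A].
    destruct (b' (j + n)%nat); [destruct A as [_ [_ A]]|]; lia. }
  split; [cbv beta; rewrite Nat.add_0_r; lia|]. intros n. specialize (M n).
  destruct (D (j + n)%nat) as [A B]. cbv beta. replace (j + S n)%nat with (S (j + n)) by lia.
  replace (pos j + (pos (j + n) - pos j))%nat with (pos (j + n)%nat) by lia.
  replace (pos j + (pos (j + n) - pos j + 1))%nat with (pos (j + n) + 1)%nat by lia.
  replace (pos j + (pos (j + n) - pos j + 2))%nat with (pos (j + n) + 2)%nat by lia.
  split; [easy|]. destruct (b' (j + n)%nat); [|lia]. repeat split; try easy. lia.
Qed.

(** * The sequence u *)

(** The letters of [u] as booleans: [u] is [bits ub]. *)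
Definition ub (n : nat) : bool := nth n (Nat.iter n phi [true]) false.

Lemma ub_prefix n i : (i < length (Nat.iter n phi [true]))%nat ->
  nth i (Nat.iter n phi [true]) false = ub i.
Proof.
  intros Hi. unfold ub. assert (Hl := phi_iter_length i).
  destruct (Nat.le_ge_cases i n) as [L|L];
    destruct (phi_iter_extend_le _ _ L) as [w E]; rewrite E; now rewrite app_nth1.
Qed.

(** [u] is the fixed point of [phi]. *)
Lemma ub_desubst : desubst ub ub (fun j => length (phi (map ub (seq 0 j)))).
Proof.
  split; [easy|]. intros j.
  set (W := Nat.iter j phi [true]). assert (Hl := phi_iter_length j). fold W in Hl.
  assert (E : W = map ub (seq 0 j) ++ ub j :: skipn (S j) W).
  { apply nth_ext with (d := false) (d' := false).
    - rewrite length_app, length_map, length_seq. cbn [length]. rewrite length_skipn. lia.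
    - intros i Hi. unfold W at 1. rewrite ub_prefix by exact Hi.
      destruct (lt_eq_lt_dec i j) as [[L|L]|L].
      + rewrite app_nth1 by (now rewrite length_map, length_seq).
        rewrite nth_indep with (d' := ub 0) by (now rewrite length_map, length_seq).
        rewrite map_nth, seq_nth by easy. reflexivity.
      + subst i. rewrite app_nth2; rewrite length_map, length_seq; [|lia].
        now rewrite Nat.sub_diag.
      + rewrite app_nth2; rewrite length_map, length_seq; [|lia].
        replace (i - j)%nat with (S (i - S j)) by lia. cbn [nth].
        rewrite nth_skipn. replace (S j + (i - S j))%nat with i by lia.
        symmetry. now apply ub_prefix. }
  set (p := phi (map ub (seq 0 j))).
  assert (EW : Nat.iter (S j) phi [true] = p ++ phi_letter (ub j) ++ phi (skipn (S j) W)).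
  { change (Nat.iter (S j) phi [true]) with (phi W). rewrite E at 1.
    unfold phi at 1. rewrite flat_map_app. reflexivity. }
  assert (Hn : forall m, (m < length (phi_letter (ub j)))%nat ->
    ub (length p + m) = nth m (phi_letter (ub j)) false).
  { intros m Hm. rewrite <- (ub_prefix (S j)) by (rewrite EW, !length_app; lia).
    rewrite EW, app_nth2_plus. now apply app_nth1. }
  assert (Hp : length (phi (map ub (seq 0 (S j)))) = (length p + length (phi_letter (ub j)))%nat).
  { rewrite seq_S, map_app. unfold phi at 1. rewrite flat_map_app, length_app. simpl flat_map.
    now rewrite app_nil_r. }
  rewrite Hp. destruct (ub j); simpl length in *.
  - split; [rewrite <- (Nat.add_0_r (length p)); now rewrite Hn by lia|].
    now rewrite !Hn by lia.
  - split; [rewrite <- (Nat.add_0_r (length p)); now rewrite Hn by lia|easy].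
Qed.

(** A shift that begins with 1 is the image of an earlier shift. *)
Lemma u_admissible : admissible u.
Proof.
  intros k. induction k as [k IH] using (well_founded_induction lt_wf).
  destruct k as [|k]; [apply le_alt_refl|].
  destruct (ub (S k)) eqn:E.
  - assert (D := ub_desubst). set (pos := fun j => length (phi (map ub (seq 0 j)))) in *.
    destruct (desubst_pos_surj _ _ _ _ D E) as [j Hj].
    assert (Hjk : (j < S k)%nat).
    { assert (P1 : pos 1%nat = 3%nat) by reflexivity.
      assert (G := desubst_pos_ge _ _ _ (desubst_drop _ _ _ 1 D)).
      destruct j as [|j]; [discriminate Hj|]. specialize (G j). cbv beta in G.
      change (1 + j)%nat with (S j) in G. destruct j; lia. }
    rewrite <- Hj. exact (desubst_le _ _ _ _ _ _ (desubst_drop _ _ _ j D) D (IH j Hjk)).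
  - left. exists 0%nat. split; [lia|]. simpl Nat.even. cbv iota.
    unfold seq_drop. rewrite Nat.add_0_r. change (Z.b2z (ub (S k)) < 1)%Z. now rewrite E.
Qed.

Lemma u_nonneg n : (0 <= u n)%Z.
Proof. change (0 <= Z.b2z (ub n))%Z. now destruct (ub n). Qed.

(** As [u] is its own desubstitution, it would have an orbit at every level; but
    the word 1001 requires [beta ^ g < beta + 1] at the level with exponents
    [h] and [g]. *)
Lemma u_not_expands beta t : 1 < beta -> expands_one beta u t -> False.
Proof.
  intros Hb [Ho [H0 Ht]].
  assert (G : forall n, exists p h g y, (n <= g)%nat /\ level p h g /\
    level_orbit p h g beta ub y /\ y 0%nat = tau p beta).
  { induction n as [|n [p [h [g [y [Hn [L [Hy Hy0]]]]]]]].
    - exists false, 1%nat, 1%nat, (fun k => t k - 1 / (beta + 1)).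
      split; [lia|]. split; [exact level_0|]. split.
      + apply level_orbit_0 with u; trivial. intros k. apply Ht.
      + rewrite H0. unfold tau. field. lra.
    - destruct (level_orbit_desubst _ _ _ _ _ _ _ _ L Hb Hy ub_desubst) as [y' [A B]].
      exists (negb p), g, (g + 2 * h)%nat, y'. destruct (level_spec _ _ _ L) as [C _].
      split; [lia|]. split; [now apply level_S|]. auto. }
  destruct (pow_unbounded beta (beta + 1) 1) as [n Hn]; [lra|lra|].
  destruct (G n) as [p [h [g [y [Hg [L [[Hy HyT] Hy0]]]]]]].
  destruct (level_slopes _ _ _ _ L Hb) as [A [B _]]. destruct (tau_bounds p beta Hb) as [C D].
  assert (E0 := skew_true _ _ _ _ Hy 0 eq_refl). assert (E1 := skew_false _ _ _ _ Hy 1 eq_refl).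
  assert (E2 := skew_false _ _ _ _ Hy 2 eq_refl).
  assert (E3 := skew_pos (beta ^ h) (beta ^ g) _ ub y ltac:(lra) C Hy HyT 3 eq_refl).
  rewrite E2, E1, E0, Hy0 in E3.
  assert (F : 0 < 1 - beta ^ g * tau p beta) by nra.
  assert (F2 : beta ^ g * (tau p beta * (beta + 1)) < beta + 1).
  { rewrite <- Rmult_assoc. rewrite <- (Rmult_1_l (beta + 1)) at 2.
    apply Rmult_lt_compat_r; lra. }
  assert (F3 : beta ^ n <= beta ^ g) by (apply Rle_pow; [lra|easy]).
  rewrite D in F2. destruct p; nra.
Qed.

(** Since [u] does not expand 1, it has an orbit starting below 1 in every base. By
    monotonicity a sequence below [u] cannot have an orbit starting at 1. *)
Lemma expands_one_gt_u beta c t :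
  1 < beta -> expands_one beta c t -> lt_alt u c.
Proof.
  intros Hb Hc.
  destruct (expansion_dichotomy u u_nonneg u_admissible) as [[b' [s [Hb' Hs]]]|H].
  { destruct (u_not_expands _ _ Hb' Hs). }
  destruct (H beta Hb) as [t' [Ho' [Ht' H0']]]. destruct Hc as [Ho [H0 Ht]].
  destruct (alt_total u c) as [L|[E|L]]; [easy| |]; exfalso.
  - apply (u_not_expands beta t Hb). split; [|easy]. intros k. rewrite E. apply Ho.
  - assert (A : t 0%nat <= t' 0%nat).
    { apply (orbit_monotone beta c u t t'); trivial. intros k. specialize (Ht' k). lra. }
    lra.
Qed.

Lemma first_diff_u_10 i b : first_diff i u (bits b) -> b 0%nat = true /\ b 1%nat = false.
Proof.
  unfold bits. intros [A B]. change u with (bits ub) in *. unfold bits in *.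
  destruct i as [|[|i]].
  - simpl in B. destruct (b 0%nat); simpl in B; lia.
  - simpl in B. destruct (b 1%nat); simpl in B; lia.
  - assert (A0 := A 0%nat ltac:(lia)). assert (A1 := A 1%nat ltac:(lia)).
    simpl in A0, A1. now destruct (b 0%nat), (b 1%nat).
Qed.

(** For [beta] close to 1 both sides of the second bound are almost 1/2; their
    difference is of the order of [beta - 1]. *)
Lemma level_blocks_small p h g beta : level p h g -> 1 < beta -> beta ^ (5 * h) < 2 ->
  0 < 1 - beta ^ g * tau p beta /\
  tau p beta < (1 - beta ^ g * tau p beta) * (beta ^ h * beta ^ h * beta ^ h * beta ^ h).
Proof.
  intros L Hb H. destruct (level_slopes _ _ _ _ L Hb) as [A [B C]].
  destruct (tau_bounds p beta Hb) as [D E]. destruct (level_spec _ _ _ L) as [G _].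
  set (s0 := beta ^ h) in *. set (s1 := beta ^ g) in *. set (w := s0 * s0) in *.
  assert (W : 1 < w) by (unfold w; nra).
  assert (S4 : beta * (w * w) < 2).
  { apply Rle_lt_trans with (2 := H). replace (5 * h)%nat with (h + (h + h + (h + h)))%nat by lia.
    rewrite !pow_add. fold s0. unfold w.
    apply Rmult_le_compat_r; [nra|]. unfold s0. rewrite <- (pow_1 beta) at 1.
    apply Rle_pow; [lra|lia]. }
  replace (w * s0 * s0) with (w * w) by (unfold w; ring).
  assert (X : tau p beta * (beta + 1) < (1 - s1 * tau p beta) * (w * w) * (beta + 1)).
  { replace ((1 - s1 * tau p beta) * (w * w) * (beta + 1))
      with ((beta + 1 - s1 * (tau p beta * (beta + 1))) * (w * w)) by ring.
    rewrite E. clearbody s0 s1 w. clear - S4 W Hb C. destruct p.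
    - rewrite C. assert (0 < (w - 1) * (w + 1 - beta * (w * w))) by (apply Rmult_lt_0_compat; lra). nra.
    - assert (V : w * w < 2) by nra.
      assert (0 < (w - 1) * (beta * (w + 1) - w * w)) by (apply Rmult_lt_0_compat; nra). nra. }
  assert (Y : tau p beta < (1 - s1 * tau p beta) * (w * w)).
  { apply Rmult_lt_reg_r with (beta + 1); [lra|exact X]. }
  split; [|exact Y]. assert (0 < w * w) by nra. nra.
Qed.

(** Close to 1 many desubstitutions are possible; each of them brings the first
    difference with [u] closer to the beginning. *)
Lemma level_orbit_gt_u_absurd i : forall p h g beta b y,
  level p h g -> 1 < beta -> beta ^ (5 * h * 3 ^ i) < 2 ->
  level_orbit p h g beta b y -> first_diff i u (bits b) -> False.
Proof.
  induction i as [i IH] using (well_founded_induction lt_wf).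
  intros p h g beta b y L Hb H Hy HF.
  destruct (first_diff_u_10 _ _ HF) as [E0 _].
  assert (P3 := Nat.pow_nonzero 3 i).
  assert (H' : beta ^ (5 * h) < 2).
  { apply Rle_lt_trans with (2 := H). apply Rle_pow; [lra|]. nia. }
  destruct (level_blocks_small _ _ _ _ L Hb H') as [K1 K2].
  destruct (level_slopes _ _ _ _ L Hb) as [A [B _]]. destruct (tau_bounds p beta Hb) as [C _].
  destruct (desubst_exists b E0) as [b' [pos D]].
  { destruct Hy as [Hy HyT]. apply (skew_blocks (beta ^ h) (beta ^ g) (tau p beta) b y); trivial; lra. }
  destruct (desubst_first_diff_inv ub ub _ b b' pos i ub_desubst D HF) as [i' [Hi HF']].
  destruct (level_orbit_desubst _ _ _ _ _ _ _ _ L Hb Hy D) as [y' [Hy' _]].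
  apply (IH i' Hi _ _ _ beta b' y' (level_S _ _ _ L) Hb); trivial.
  apply Rle_lt_trans with (2 := H). apply Rle_pow; [lra|].
  destruct (level_spec _ _ _ L) as [G1 G2].
  assert (Hg : (g <= 3 * h)%nat) by (destruct p; lia).
  assert (Hp : (3 * 3 ^ i' <= 3 ^ i)%nat).
  { change (3 * 3 ^ i')%nat with (3 ^ S i')%nat. apply Nat.pow_le_mono_r; lia. }
  nia.
Qed.

Lemma pow_close_to_1 M : exists beta, 1 < beta /\ beta ^ M < 2.
Proof.
  set (d := / (2 * INR M + 2)). assert (K := pos_INR M).
  assert (Hd : 0 < d) by (apply Rinv_0_lt_compat; lra).
  assert (Ed : d * (2 * INR M + 2) = 1) by (unfold d; field; lra).
  exists (1 + d). split; [lra|].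
  assert (G : forall n, (n <= M)%nat -> (1 + d) ^ n * (1 - INR n * d) <= 1).
  { induction n as [|n IH]; intros Hn; [simpl; lra|].
    specialize (IH ltac:(lia)). rewrite S_INR. simpl pow.
    assert (0 < (1 + d) ^ n) by (apply pow_lt; lra). assert (Kn := pos_INR n).
    apply Rle_trans with (2 := IH).
    replace ((1 + d) * (1 + d) ^ n * (1 - (INR n + 1) * d))
      with ((1 + d) ^ n * ((1 + d) * (1 - (INR n + 1) * d))) by ring.
    apply Rmult_le_compat_l; [lra|]. nra. }
  specialize (G M (le_n M)). assert (0 < (1 + d) ^ M) by (apply pow_lt; lra). nra.
Qed.

Lemma expansion_exists a :
  (forall n, (0 <= a n)%Z) -> admissible a -> lt_alt u a ->
  exists beta t, 1 < beta /\ expands_one beta a t.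
Proof.
  intros Ha Hadm [i Hu].
  destruct (expansion_dichotomy a Ha Hadm) as [H|H]; [exact H|exfalso].
  destruct (pow_close_to_1 (5 * 1 * 3 ^ i)) as [beta [Hb HM]].
  destruct (H beta Hb) as [t [Ho [Ht H0]]].
  assert (Ht' : forall k, 0 <= t k <= 1) by (intros k; specialize (Ht k); lra).
  set (b := fun n => (a n =? 1)%Z).
  assert (Hab : forall n, a n = Z.b2z (b n)).
  { apply (expands_one_bits beta a t); trivial.
    assert (beta ^ 5 <= beta ^ (5 * 1 * 3 ^ i)).
    { apply Rle_pow; [lra|]. assert (P3 := Nat.pow_nonzero 3 i). nia. }
    assert (B2 : 1 < beta * beta) by nra.
    replace (beta ^ 5) with (beta * beta * (beta * beta) * beta) in H1 by ring.
    assert (B4 : beta * beta <= beta * beta * (beta * beta)) by nra. nra. }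
  apply (level_orbit_gt_u_absurd i false 1 1 beta b (fun k => t k - 1 / (beta + 1)) level_0 Hb HM).
  - apply level_orbit_0 with a; trivial. intros k. apply Ht'.
  - destruct Hu as [U1 U2]. unfold bits. split.
    + intros j Hj. rewrite <- Hab. now apply U1.
    + rewrite <- Hab. exact U2.
Qed.

(** * Admissible periodic sequences *)

Definition has_border (k : nat) (c : nat -> Z) (i : nat) : Prop :=
  forall m, (m < k - i)%nat -> c (i + m)%nat = c m.

Definition suffix_lt (k : nat) (c : nat -> Z) (i : nat) : Prop :=
  exists m, (m < k - i)%nat /\ first_diff m (seq_drop i c) c.

Section Periodic.
Variables (k : nat) (c : nat -> Z).
Hypothesis Hk : (1 <= k)%nat.
Hypothesis Hc : forall n, c (k + n)%nat = c n.

Lemma period_mul q n : c (q * k + n)%nat = c n.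
Proof.
  induction q as [|q IH]; [easy|]. simpl. rewrite <- Nat.add_assoc, Hc. exact IH.
Qed.

Lemma period_mod n : c n = c (n mod k)%nat.
Proof.
  rewrite (Nat.div_mod n k) at 1 by lia. rewrite Nat.mul_comm. apply period_mul.
Qed.

(** Two complementary borders are two commuting factors of the period. *)
Lemma two_borders_eq i : (0 < i < k)%nat -> has_border k c i -> has_border k c (k - i) ->
  seq_eq (seq_drop i c) c.
Proof.
  intros Hi B1 B2 n. unfold seq_drop.
  induction n as [n IH] using (well_founded_induction lt_wf).
  destruct (lt_dec n (k - i)) as [L|L]; [now apply B1|].
  set (m := (n - (k - i))%nat). replace n with (k - i + m)%nat by (unfold m; lia).
  replace (i + (k - i + m))%nat with (k + m)%nat by lia. rewrite Hc.
  destruct (lt_dec m i) as [L'|L'].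
  - symmetry. apply B2. lia.
  - set (m' := (m - i)%nat). replace m with (i + m')%nat by (unfold m'; lia).
    replace (k - i + (i + m'))%nat with (k + m')%nat by lia. rewrite Hc.
    apply IH. unfold m', m. lia.
Qed.

(** After a border of odd length [k - i], comparing the shift by [i] with [c]
    amounts to comparing [c] with the shift by [k - i]. *)
Lemma periodic_admissible :
  (forall i, (0 < i < k)%nat -> suffix_lt k c i \/
    (has_border k c i /\ (Nat.even (k - i) = false \/ has_border k c (k - i)))) ->
  admissible c.
Proof.
  intros H.
  assert (G : forall i, (i < k)%nat -> le_alt (seq_drop i c) c).
  { intros i Hi. destruct (Nat.eq_dec i 0) as [->|H0]; [apply le_alt_refl|].
    destruct (H i ltac:(lia)) as [[m [_ S]]|[B1 [O|B2]]].
    - left. now exists m.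
    - destruct (H (k - i)%nat ltac:(lia)) as [[m [_ S]]|[B2 _]].
      + left. apply (lt_alt_drop_inv (k - i)).
        * intros n Hn. now apply B1.
        * rewrite O. apply (lt_alt_ext (seq_drop (k - i) c) c).
          -- now intros n.
          -- intros n. unfold seq_drop. replace (i + (k - i + n))%nat with (k + n)%nat by lia.
             now rewrite Hc.
          -- now exists m.
      + right. apply two_borders_eq; trivial. lia.
    - right. apply two_borders_eq; trivial. lia. }
  intros n. apply (le_alt_ext (seq_drop (n mod k) c) c); [|now intros m|].
  - intros m. unfold seq_drop. rewrite (Nat.div_mod n k) at 2 by lia.
    rewrite Nat.mul_comm, <- Nat.add_assoc, period_mul. reflexivity.
  - apply G. apply Nat.mod_upper_bound. lia.
Qed.

End Periodic.

(** [c] is a sequence of period [k]; [x] is a concatenation of words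
    [c_1 ... c_k] and [c_1 ... c_(k-1) (c_k - 1) 0], which begin at the
    positions [p n]. Both pairs of words of the theorem have this form. *)
Definition full_block (k : nat) (c x : nat -> Z) (q : nat) : Prop :=
  forall m, (m < k)%nat -> x (q + m)%nat = c m.

Definition cut_block (k : nat) (c x : nat -> Z) (q : nat) : Prop :=
  (forall m, (S m < k)%nat -> x (q + m)%nat = c m) /\
  x (q + (k - 1))%nat = (c (k - 1)%nat - 1)%Z /\ x (q + k)%nat = 0%Z.

Definition block_coded (k : nat) (c x : nat -> Z) (p : nat -> nat) : Prop :=
  p 0%nat = 0%nat /\ forall n,
    (p (S n) = (p n + k)%nat /\ full_block k c x (p n)) \/
    (p (S n) = (p n + S k)%nat /\ cut_block k c x (p n)).

Lemma block_coded_index k c x p : (1 <= k)%nat -> block_coded k c x p ->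
  forall i, exists n m, i = (p n + m)%nat /\ (p n + m < p (S n))%nat.
Proof.
  intros Hk [H0 H] i. assert (G : forall n, (exists n' m, i = (p n' + m)%nat /\ (p n' + m < p (S n'))%nat)
    \/ (p n <= i)%nat).
  { induction n as [|n [IH|IH]]; [right; lia|now left|].
    destruct (le_lt_dec (p (S n)) i) as [L|L]; [now right|left].
    exists n, (i - p n)%nat. lia. }
  assert (P : forall n, (n <= p n)%nat).
  { induction n as [|n IH]; [lia|]. destruct (H n) as [[A _]|[A _]]; lia. }
  destruct (G (S i)) as [F|F]; [easy|]. specialize (P (S i)). lia.
Qed.

(** If a border has even length [k - i], then [seq_drop (k - i) a] lies between
    [seq_drop k a] and [a], which have the same first letters, so that the
    complementary prefix is a border too. *)
Lemma period_admissible_of_return k a : (1 <= k)%nat -> admissible a ->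
  (forall m, (S m < k)%nat -> a (k + m)%nat = a m) ->
  forall c, (forall n, c (k + n)%nat = c n) -> (forall m, (m < k)%nat -> c m = a m) ->
  admissible c.
Proof.
  intros Hk Ha Hka c Hc Hca. apply (periodic_admissible k c Hk Hc). intros i Hi.
  destruct (classic (suffix_lt k c i)) as [Sf|Sf]; [now left|right].
  assert (B : forall m, (m < k - i)%nat -> seq_drop i a m = a m).
  { destruct (Ha i) as [[m [F1 F2]]|E].
    - intros n Hn. apply F1. apply Nat.nle_gt. intros L. apply Sf. exists m. split; [lia|].
      split.
      + intros j Hj. unfold seq_drop. rewrite !Hca by lia. now apply F1.
      + unfold seq_drop in *. rewrite !Hca by lia. exact F2.
    - intros m _. apply E. }
  assert (B' : has_border k c i).
  { intros m Hm. rewrite !Hca by lia. now apply B. }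
  split; [exact B'|]. destruct (Nat.even (k - i)) eqn:Ev; [right|now left].
  assert (L1 := le_alt_drop (k - i) _ _ B (Ha i)). rewrite Ev in L1.
  assert (L2 : le_alt (seq_drop k a) (seq_drop (k - i) a)).
  { apply (le_alt_ext _ _ _ _) with (3 := L1); [|now intros n].
    intros n. unfold seq_drop. f_equal. lia. }
  assert (Q := le_alt_squeeze (k - 1) _ _ _ L2 (Ha (k - i)%nat)).
  intros m Hm. rewrite !Hca by lia. apply Q; [|lia].
  intros j Hj. apply Hka. lia.
Qed.

(** The suffixes of the period occur in [a] inside the block at [q]. A border of
    even length is impossible because of the smaller last letter in [a] itself. *)
Lemma period_admissible_of_block k a q : (1 <= k)%nat -> admissible a ->
  forall c, (forall n, c (k + n)%nat = c n) -> (forall m, (S m < k)%nat -> c m = a m) ->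
  c (k - 1)%nat = (a (k - 1)%nat + 1)%Z -> full_block k c a q ->
  admissible c.
Proof.
  intros Hk Ha c Hc Hca Hlast Hq. apply (periodic_admissible k c Hk Hc). intros i Hi.
  destruct (classic (suffix_lt k c i)) as [Sf|Sf]; [now left|right].
  assert (B : has_border k c i).
  { destruct (Ha (q + i)%nat) as [[m [F1 F2]]|E].
    - intros n Hn. rewrite (Hca n) by lia. rewrite <- F1.
      + unfold seq_drop. rewrite <- Nat.add_assoc. symmetry. apply Hq. lia.
      + apply Nat.nle_gt. intros L. apply Sf. exists m. split; [lia|].
        assert (E : forall j, (j <= m)%nat -> seq_drop (q + i) a j = seq_drop i c j).
        { intros j Hj. unfold seq_drop. rewrite <- Nat.add_assoc. apply Hq. lia. }
        split.
        * intros j Hj. rewrite <- E by lia. rewrite F1 by easy. symmetry. apply Hca. lia.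
        * rewrite <- E by lia. rewrite Hca by lia. exact F2.
    - intros m Hm. rewrite (Hca m) by lia. rewrite <- E. unfold seq_drop.
      rewrite <- Nat.add_assoc. symmetry. apply Hq. lia. }
  split; [exact B|left].
  destruct (Nat.even (k - i)) eqn:Ev; [exfalso|easy].
  (* The prefix of [a] of length [k] ends with the border, its last letter
     decreased by 1; in an even position this makes it larger than the border. *)
  apply (lt_alt_not_le a (seq_drop i a)); [|apply Ha].
  exists (k - i - 1)%nat. split.
  - intros m Hm. unfold seq_drop. rewrite <- !Hca by lia. symmetry. apply B. lia.
  - assert (Ev' : Nat.even (k - i - 1) = false).
    { assert (X := even_S_negb (k - i - 1)). replace (S (k - i - 1)) with (k - i)%nat in X by lia.
      rewrite Ev in X. now destruct (Nat.even (k - i - 1)). }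
    rewrite Ev'. unfold seq_drop.
    assert (E1 := B (k - i - 1)%nat ltac:(lia)).
    replace (i + (k - i - 1))%nat with (k - 1)%nat in * by lia.
    rewrite (Hca (k - i - 1)%nat) in E1 by lia. lia.
Qed.

(** * Block codings and orbits *)

Lemma orbit_determined beta x t t' :
  orbit beta x t -> orbit beta x t' -> t 0%nat = t' 0%nat -> forall n, t n = t' n.
Proof.
  intros H H' H0 n. induction n as [|n IH]; [easy|]. now rewrite H, H', IH.
Qed.

(** The value of an orbit is a function of the sequence of digits. *)
Lemma expands_one_period k beta c t :
  (1 <= k)%nat -> 1 < beta -> (forall n, c (k + n)%nat = c n) ->
  expands_one beta c t -> t k = 1.
Proof.
  intros Hk Hb Hc [Ho [H0 Ht]].
  assert (E : alt_series beta (seq_drop k c) = alt_series beta c).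
  { apply Series_ext. intros n. unfold seq_drop. now rewrite Hc. }
  rewrite (orbit_series beta c t) in E; trivial.
  rewrite (orbit_series beta _ _ Hb (orbit_drop beta c t k Ho)) in E; [|intros; apply Ht].
  rewrite Nat.add_0_r in E. lra.
Qed.

(** A block [c_1 ... c_k] leads from 1 to 1, hence the decreased last letter leads
    to 0, and the letter 0 from there to 1. *)
Lemma block_coded_expands k beta c x p T :
  (1 <= k)%nat -> 1 < beta -> (forall n, c (k + n)%nat = c n) ->
  expands_one beta c T -> block_coded k c x p ->
  exists t, expands_one beta x t /\
    forall n, cut_block k c x (p n) -> t (p n + k)%nat = 0.
Proof.
  intros Hk Hb Hc HT HB. assert (Tk := expands_one_period k beta c T Hk Hb Hc HT).
  destruct HT as [To [T0 Tr]].
  set (t := fix t n := match n with O => 1 | S n => IZR (x n) + 1 - beta * t n end).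
  assert (Ho : orbit beta x t) by now intros n.
  assert (Run : forall q, t q = 1 -> (forall m, (S m < k)%nat -> x (q + m)%nat = c m) ->
    forall m, (m < k)%nat -> t (q + m)%nat = T m).
  { intros q Hq Hx. induction m as [|m IH]; intros Hm; [now rewrite Nat.add_0_r, Hq|].
    rewrite Nat.add_succ_r, Ho, To, Hx, IH by lia. reflexivity. }
  assert (Last : T k = IZR (c (k - 1)%nat) + 1 - beta * T (k - 1)%nat).
  { rewrite <- To. f_equal. lia. }
  assert (Full : forall q, t q = 1 -> full_block k c x q -> t (q + k)%nat = 1).
  { intros q Hq Hx. replace (q + k)%nat with (S (q + (k - 1))) by lia.
    rewrite Ho, Hx by lia. rewrite (Run q Hq) by (intros; try apply Hx; lia). lra. }
  assert (Cut : forall q, t q = 1 -> cut_block k c x q ->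
    t (q + k)%nat = 0 /\ t (q + S k)%nat = 1).
  { intros q Hq [Hx1 [Hx2 Hx3]]. assert (E : t (q + k)%nat = 0).
    { replace (q + k)%nat with (S (q + (k - 1))) by lia.
      rewrite Ho, Hx2, minus_IZR. rewrite (Run q Hq) by (trivial; lia). lra. }
    split; [exact E|]. rewrite Nat.add_succ_r, Ho, Hx3, E. lra. }
  assert (H1 : forall n, t (p n) = 1).
  { destruct HB as [P0 P]. induction n as [|n IH]; [now rewrite P0|].
    destruct (P n) as [[A B]|[A B]]; rewrite A; [now apply Full|now apply Cut]. }
  exists t. split; [|intros n Hn; now apply Cut].
  split; [exact Ho|]. split; [easy|]. intros i.
  destruct (block_coded_index k c x p Hk HB i) as [n [m [-> Hm]]].
  destruct HB as [P0 P].
  assert (HR : (forall m, (S m < k)%nat -> x (p n + m)%nat = c m)).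
  { intros j Hj. destruct (P n) as [[A B]|[A B]]; apply B; lia. }
  destruct (lt_dec m k) as [L|L]; [rewrite (Run _ (H1 n) HR m L); apply Tr|].
  destruct (P n) as [[A B]|[A B]]; [lia|]. replace m with k by lia.
  rewrite (proj1 (Cut _ (H1 n) B)). lra.
Qed.

Lemma mod_succ_cases n k : (1 <= k)%nat ->
  (S (n mod k) < k /\ S n mod k = S (n mod k))%nat \/
  (n mod k = k - 1 /\ S n mod k = 0)%nat.
Proof.
  intros Hk. assert (B := Nat.mod_upper_bound n k ltac:(lia)).
  assert (E := Nat.div_mod n k ltac:(lia)).
  destruct (lt_dec (S (n mod k)) k) as [L|L]; [left|right]; split; trivial; try lia.
  - symmetry. apply (Nat.mod_unique _ _ (n / k)%nat); lia.
  - symmetry. apply (Nat.mod_unique _ _ (S (n / k))%nat); nia.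
Qed.

Lemma periodic_expands k beta x c t :
  (1 <= k)%nat -> expands_one beta x t -> (forall n, c (k + n)%nat = c n) ->
  (forall m, (S m < k)%nat -> c m = x m) ->
  IZR (c (k - 1)%nat) - beta * t (k - 1)%nat = 0 ->
  expands_one beta c (fun n => t (n mod k)%nat).
Proof.
  intros Hk [Ho [H0 Ht]] Hc Hx Hl. split; [|split].
  - intros n. rewrite (period_mod k c Hk Hc n).
    destruct (mod_succ_cases n k Hk) as [[A B]|[A B]]; rewrite B.
    + rewrite Ho, Hx by exact A. reflexivity.
    + rewrite A, H0. lra.
  - rewrite Nat.mod_small by lia. exact H0.
  - intros n. apply Ht.
Qed.

(** As long as the orbit of 1 stays inside the open interval, its digits are
    the only possible ones; this leaves a choice only at the [k]-th letter. *)
Lemma expands_block_coded k beta x c t :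
  (1 <= k)%nat -> (forall n, (0 <= x n)%Z) -> expands_one beta x t ->
  (forall m, (0 < m < k)%nat -> 0 < t m < 1) ->
  (forall m, (S m < k)%nat -> c m = x m) ->
  IZR (c (k - 1)%nat) - beta * t (k - 1)%nat = 0 ->
  exists p, block_coded k c x p.
Proof.
  intros Hk Hx0 [Ho [H0 Ht]] Hm Hc Hl.
  assert (Run : forall q, t q = 1 -> forall m, (m < k)%nat -> t (q + m)%nat = t m /\
    ((S m < k)%nat -> x (q + m)%nat = c m)).
  { intros q Hq. induction m as [|m IH]; intros L.
    - rewrite Nat.add_0_r, H0. split; [exact Hq|]. intros L'. rewrite Hc by easy.
      assert (A := Ho q). assert (B := Ho 0%nat). assert (C := Ht (S q)).
      assert (D := Hm 1%nat ltac:(lia)). rewrite Hq in A. rewrite H0 in B.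
      assert (E1 : IZR (x q) < IZR (x 0%nat) + 1) by lra.
      assert (E2 : IZR (x 0%nat) < IZR (x q) + 1) by lra.
      rewrite <- plus_IZR in E1, E2. apply lt_IZR in E1, E2. lia.
    - destruct IH as [A B]; [lia|]. specialize (B L).
      assert (E : t (q + S m)%nat = t (S m)).
      { rewrite Nat.add_succ_r, !Ho, A, B, Hc by easy. reflexivity. }
      split; [exact E|]. intros L'. rewrite Hc by easy.
      assert (A' := Ho (q + S m)%nat). assert (B' := Ho (S m)). rewrite E in A'.
      assert (C := Ht (S (q + S m))). assert (D := Hm (S (S m)) ltac:(lia)).
      assert (E1 : IZR (x (q + S m)%nat) < IZR (x (S m)) + 1) by lra.
      assert (E2 : IZR (x (S m)) < IZR (x (q + S m)%nat) + 1) by lra.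
      rewrite <- plus_IZR in E1, E2. apply lt_IZR in E1, E2. lia. }
  assert (Last : forall q, t q = 1 ->
    t (q + k)%nat = IZR (x (q + (k - 1))%nat) - IZR (c (k - 1)%nat) + 1).
  { intros q Hq. replace (q + k)%nat with (S (q + (k - 1))) by lia.
    rewrite Ho, (proj1 (Run q Hq (k - 1)%nat ltac:(lia))). lra. }
  set (p := fix p n := match n with O => O | S n =>
    if Z.eq_dec (x (p n + (k - 1))%nat) (c (k - 1)%nat) then (p n + k)%nat
    else (p n + S k)%nat end).
  assert (Step : forall q, t q = 1 ->
    if Z.eq_dec (x (q + (k - 1))%nat) (c (k - 1)%nat)
    then t (q + k)%nat = 1 /\ full_block k c x q
    else t (q + S k)%nat = 1 /\ cut_block k c x q).
  { intros q Hq. assert (L := Last q Hq). assert (B := Ht (q + k)%nat).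
    destruct (Z.eq_dec (x (q + (k - 1))%nat) (c (k - 1)%nat)) as [E|E].
    - rewrite E in L. split; [lra|]. intros m Hmk.
      destruct (lt_dec (S m) k) as [L1|L1]; [now apply (Run q Hq)|].
      replace m with (k - 1)%nat by lia. exact E.
    - rewrite L in B.
      assert (E1 : IZR (x (q + (k - 1))%nat) <= IZR (c (k - 1)%nat)) by lra.
      assert (E2 : IZR (c (k - 1)%nat) <= IZR (x (q + (k - 1))%nat) + 1) by lra.
      rewrite <- plus_IZR in E2. apply le_IZR in E1, E2.
      assert (E3 : x (q + (k - 1))%nat = (c (k - 1)%nat - 1)%Z) by lia.
      rewrite E3, minus_IZR in L. assert (Z0 : t (q + k)%nat = 0) by lra.
      assert (N := Ho (q + k)%nat). rewrite Z0 in N. assert (R := Ht (S (q + k))).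
      assert (X : x (q + k)%nat = 0%Z).
      { assert (F : IZR (x (q + k)%nat) <= 0) by lra. apply le_IZR in F.
        specialize (Hx0 (q + k)%nat). lia. }
      rewrite Nat.add_succ_r. split; [rewrite N, X; lra|].
      split; [|split; trivial]. intros m Hmk. apply (Run q Hq); lia. }
  assert (H1 : forall n, t (p n) = 1).
  { induction n as [|n IH]; [exact H0|]. specialize (Step _ IH). simpl.
    destruct (Z.eq_dec (x (p n + (k - 1))%nat) (c (k - 1)%nat)); apply Step. }
  exists p. split; [easy|]. intros n. specialize (Step _ (H1 n)). simpl.
  destruct (Z.eq_dec (x (p n + (k - 1))%nat) (c (k - 1)%nat)); [left|right]; now split.
Qed.

(** * Block codings and concatenations of words *)

Lemma starts_with_nth x w : starts_with x w <->
  forall m, (m < length w)%nat -> x m = nth m w 0%Z.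
Proof.
  unfold starts_with, seq_take. split.
  - intros E m Hm. rewrite <- E.
    rewrite nth_indep with (d' := x 0%nat) by (now rewrite length_map, length_seq).
    now rewrite map_nth, seq_nth.
  - intros H. apply nth_ext with (d := x 0%nat) (d' := 0%Z); rewrite length_map, length_seq; [easy|].
    intros m Hm. now rewrite map_nth, seq_nth, <- H.
Qed.

Lemma in_omega_positions v w x : in_omega v w x <->
  exists p, p 0%nat = 0%nat /\ forall n, exists s, (s = v \/ s = w) /\
    p (S n) = (p n + length s)%nat /\
    forall m, (m < length s)%nat -> x (p n + m)%nat = nth m s 0%Z.
Proof.
  split.
  - intros [B [HB Hx]]. exists (fun n => length (concat (map B (seq 0 n)))).
    split; [easy|]. intros n. exists (B n). split; [apply HB|].
    assert (E : concat (map B (seq 0 (S n))) = concat (map B (seq 0 n)) ++ B n).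
    { rewrite seq_S, map_app, concat_app. simpl. now rewrite app_nil_r. }
    rewrite E, length_app. split; [easy|]. intros m Hm.
    specialize (Hx (S n)). rewrite E in Hx. rewrite starts_with_nth in Hx.
    rewrite Hx by (rewrite length_app; lia). apply app_nth2_plus.
  - intros [p [P0 P]].
    assert (P' : forall n, {s | (s = v \/ s = w) /\ p (S n) = (p n + length s)%nat /\
      forall m, (m < length s)%nat -> x (p n + m)%nat = nth m s 0%Z})
      by (intros n; apply ClassicalEpsilon.constructive_indefinite_description, P).
    set (B := fun n => proj1_sig (P' n)). assert (HB := fun n => proj2_sig (P' n)).
    exists B. split; [intros n; apply HB|].
    assert (G : forall n, length (concat (map B (seq 0 n))) = p n /\
      starts_with x (concat (map B (seq 0 n)))).
    { induction n as [|n [IH1 IH2]]; [now rewrite P0|].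
      rewrite seq_S, map_app, concat_app. simpl. rewrite app_nil_r, length_app.
      destruct (HB n) as [_ [Q1 Q2]]. split; [now rewrite IH1, Q1|].
      rewrite starts_with_nth in *. intros m Hm. rewrite length_app, IH1 in Hm.
      destruct (lt_dec m (p n)) as [L|L].
      - rewrite app_nth1 by lia. apply IH2. lia.
      - rewrite app_nth2 by lia. rewrite IH1.
        replace m with (p n + (m - p n))%nat at 1 by lia. apply Q2.
        fold (B n). lia. }
    intros n. apply G.
Qed.

Lemma length_seq_take k a : length (seq_take k a) = k.
Proof. unfold seq_take. now rewrite length_map, length_seq. Qed.

Lemma nth_seq_take k a m : (m < k)%nat -> nth m (seq_take k a) 0%Z = a m.
Proof.
  intros Hm. unfold seq_take.
  rewrite nth_indep with (d' := a 0%nat) by (now rewrite length_map, length_seq).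
  now rewrite map_nth, seq_nth.
Qed.

Lemma nth_take_app k a s m : (m < k)%nat -> nth m (seq_take k a ++ s) 0%Z = a m.
Proof. intros Hm. rewrite app_nth1 by (now rewrite length_seq_take). now apply nth_seq_take. Qed.

Lemma nth_take_app_r k a s m : nth (k + m) (seq_take k a ++ s) 0%Z = nth m s 0%Z.
Proof. rewrite <- (length_seq_take k a) at 1. apply app_nth2_plus. Qed.

Lemma block_coded_in_omega k c x v w :
  (1 <= k)%nat -> length v = k -> length w = S k ->
  (forall m, (m < k)%nat -> nth m v 0%Z = c m) ->
  (forall m, (S m < k)%nat -> nth m w 0%Z = c m) ->
  nth (k - 1) w 0%Z = (c (k - 1)%nat - 1)%Z -> nth k w 0%Z = 0%Z ->
  (in_omega v w x <-> exists p, block_coded k c x p).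
Proof.
  intros Hk Lv Lw Hv Hw1 Hw2 Hw3. rewrite in_omega_positions. split; intros [p [P0 P]]; exists p.
  - split; [easy|]. intros n. destruct (P n) as [s [[E|E] [Q1 Q2]]]; subst s; [left|right].
    + rewrite Lv in *. split; [easy|]. intros m Hm. now rewrite Q2, Hv.
    + rewrite Lw in *. split; [easy|]. split; [|split].
      * intros m Hm. rewrite Q2 by lia. now apply Hw1.
      * rewrite Q2 by lia. exact Hw2.
      * rewrite Q2 by lia. exact Hw3.
  - split; [easy|]. intros n. destruct (P n) as [[Q1 Q2]|[Q1 [Q2 [Q3 Q4]]]].
    + exists v. rewrite Lv. split; [now left|]. split; [easy|]. intros m Hm. now rewrite Q2, Hv.
    + exists w. rewrite Lw. split; [now right|]. split; [easy|]. intros m Hm.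
      destruct (lt_dec (S m) k) as [L|L]; [now rewrite Q2, Hw1|].
      destruct (Nat.eq_dec m k) as [->|N]; [now rewrite Q4|].
      replace m with (k - 1)%nat by lia. now rewrite Q3.
Qed.

Lemma in_omega_swap v w x : in_omega v w x <-> in_omega w v x.
Proof. split; intros [B [H1 H2]]; exists B; split; trivial; intros i; destruct (H1 i); tauto. Qed.

Lemma periodic_period v n : periodic v (length v + n)%nat = periodic v n.
Proof.
  unfold periodic. destruct (length v) as [|l] eqn:E; [easy|].
  f_equal. rewrite <- E. rewrite Nat.add_comm, <- (Nat.mul_1_l (length v)) at 1.
  apply Nat.Div0.mod_add.
Qed.

Lemma periodic_nth v m : (m < length v)%nat -> periodic v m = nth m v 0%Z.
Proof. intros H. unfold periodic. now rewrite Nat.mod_small. Qed.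

(** * Zeros of the orbit of 1 *)

Lemma in_omega_words_A k a c :
  (1 <= k)%nat -> (forall m, (m < k)%nat -> c m = a m) ->
  forall x, in_omega (seq_take k a) (seq_take (k - 1) a ++ [(a (k - 1)%nat - 1)%Z; 0%Z]) x
    <-> exists p, block_coded k c x p.
Proof.
  intros Hk Hc x. apply block_coded_in_omega; trivial.
  - apply length_seq_take.
  - rewrite length_app, length_seq_take. simpl. lia.
  - intros m Hm. now rewrite nth_seq_take, Hc.
  - intros m Hm. now rewrite nth_take_app, Hc by lia.
  - replace (k - 1)%nat with (k - 1 + 0)%nat at 1 by lia.
    rewrite nth_take_app_r, Hc by lia. reflexivity.
  - replace k with (k - 1 + 1)%nat at 1 by lia. now rewrite nth_take_app_r.
Qed.

Lemma in_omega_words_B k a c :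
  (1 <= k)%nat -> (forall m, (S m < k)%nat -> c m = a m) ->
  c (k - 1)%nat = (a (k - 1)%nat + 1)%Z ->
  forall x, in_omega (seq_take k a ++ [0%Z]) (seq_take (k - 1) a ++ [(a (k - 1)%nat + 1)%Z]) x
    <-> exists p, block_coded k c x p.
Proof.
  intros Hk Hc Hl x. rewrite in_omega_swap. apply block_coded_in_omega; trivial.
  - rewrite length_app, length_seq_take. simpl. lia.
  - rewrite length_app, length_seq_take. simpl. lia.
  - intros m Hm. destruct (lt_dec (S m) k) as [L|L].
    + now rewrite nth_take_app, Hc by lia.
    + replace m with (k - 1 + 0)%nat by lia. rewrite nth_take_app_r, Nat.add_0_r, Hl. reflexivity.
  - intros m Hm. now rewrite nth_take_app, Hc by lia.
  - rewrite nth_take_app, Hl by lia. lia.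
  - replace k with (k + 0)%nat at 1 by lia. now rewrite nth_take_app_r.
Qed.

Section Zeros.
Variables (a : nat -> Z) (beta : R) (t : nat -> R).
Hypothesis Ha : forall n, (0 <= a n)%Z.
Hypothesis Hadm : admissible a.
Hypothesis Hb : 1 < beta.
Hypothesis Ht : expands_one beta a t.

(** The base attached to the periodic sequence [c] also expands 1 into [a], so
    it is [beta]. *)
Lemma coded_zero k c p n :
  (1 <= k)%nat -> (forall m, (0 <= c m)%Z) -> (forall n, c (k + n)%nat = c n) ->
  admissible c -> lt_alt u c -> block_coded k c a p -> cut_block k c a (p n) ->
  t (p n + k)%nat = 0.
Proof.
  intros Hk Hc0 Hc Hcadm Hu HB Hcut.
  destruct (expansion_exists c Hc0 Hcadm Hu) as [beta' [T [Hb' HT]]].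
  destruct (block_coded_expands k beta' c a p T Hk Hb' Hc HT HB) as [t' [Ht' Hz]].
  assert (E := expands_one_unique beta beta' a t t' Ha Hb Hb' Ht Ht'). subst beta'.
  rewrite <- (Hz n Hcut). destruct Ht as [Ho [H0 _]]. destruct Ht' as [Ho' [H0' _]].
  apply (orbit_determined beta a); trivial. now rewrite H0, H0'.
Qed.

(** [a] is not periodic, so a block with decreased last letter occurs. *)
Lemma zero_of_words_A k p c :
  (1 <= k)%nat -> (forall n, c (k + n)%nat = c n) -> (forall m, (m < k)%nat -> c m = a m) ->
  lt_alt u c -> block_coded k c a p -> ~ seq_eq a c ->
  exists j, (1 <= j)%nat /\ t j = 0.
Proof.
  intros Hk Hc Hca Hu HB Hne.
  assert (Hcut : exists n, cut_block k c a (p n)).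
  { apply NNPP. intros N. apply Hne. destruct HB as [P0 P].
    assert (G : forall n, p n = (n * k)%nat /\ full_block k c a (p n)).
    { assert (F : forall n, p (S n) = (p n + k)%nat /\ full_block k c a (p n)).
      { intros n. destruct (P n) as [Q|[_ Q]]; [easy|]. destruct N. now exists n. }
      intros n. split; [|apply F]. induction n as [|n IH]; [easy|].
      rewrite (proj1 (F n)), IH. lia. }
    intros n. destruct (G (n / k)%nat) as [G1 G2]. rewrite (period_mod k c Hk Hc).
    rewrite (Nat.div_mod n k) at 1 by lia.
    rewrite Nat.mul_comm, <- G1. apply G2. apply Nat.mod_upper_bound. lia. }
  destruct Hcut as [n Hn]. exists (p n + k)%nat. split; [lia|].
  apply (coded_zero k c p n); trivial.
  - intros m. rewrite (period_mod k c Hk Hc), Hca; [apply Ha|]. apply Nat.mod_upper_bound. lia.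
  - apply (period_admissible_of_return k a Hk Hadm); trivial. intros m Hm. destruct HB as [P0 P].
    destruct (P 0%nat) as [[P1 _]|[_ [_ [Q _]]]].
    + rewrite P0 in P1. simpl in P1. rewrite <- P1.
      destruct (P 1%nat) as [[_ Q]|[_ [Q _]]]; rewrite Q by lia; apply Hca; lia.
    + rewrite P0 in Q. simpl in Q. rewrite Hca in Q by lia. lia.
Qed.

(** The first block has the decreased last letter, since it is a prefix of [a]. If
    the other block never occurs, then [a] has period [k + 1] with last letter 0,
    and the orbit returns to 1 through 0. *)
Lemma zero_of_words_B k p c :
  (1 <= k)%nat -> (forall n, c (k + n)%nat = c n) -> (forall m, (S m < k)%nat -> c m = a m) ->
  c (k - 1)%nat = (a (k - 1)%nat + 1)%Z -> lt_alt u c -> block_coded k c a p ->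
  t k = 0.
Proof.
  intros Hk Hc Hca Hl Hu HB. destruct (HB) as [P0 P].
  assert (C0 : cut_block k c a (p 0%nat)).
  { destruct (P 0%nat) as [[_ Q]|[_ Q]]; [|easy]. exfalso.
    specialize (Q (k - 1)%nat ltac:(lia)). rewrite P0 in Q. simpl in Q. lia. }
  destruct (classic (exists n, full_block k c a (p n))) as [[q Hq]|N].
  - replace k with (p 0%nat + k)%nat by (rewrite P0; reflexivity).
    apply (coded_zero k c p 0); trivial.
    + intros m. rewrite (period_mod k c Hk Hc).
      assert (B := Nat.mod_upper_bound m k ltac:(lia)).
      destruct (lt_dec (S (m mod k)) k) as [L|L]; [rewrite Hca by easy; apply Ha|].
      replace (m mod k)%nat with (k - 1)%nat by lia. rewrite Hl. specialize (Ha (k - 1)%nat). lia.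
    + now apply (period_admissible_of_block k a (p q)).
  - assert (F : forall n, p n = (n * S k)%nat /\ cut_block k c a (p n)).
    { assert (F : forall n, p (S n) = (p n + S k)%nat /\ cut_block k c a (p n)).
      { intros n. destruct (P n) as [[_ Q]|Q]; [|easy]. destruct N. now exists n. }
      intros n. split; [|apply F]. induction n as [|n IH]; [easy|].
      rewrite (proj1 (F n)), IH. lia. }
    assert (Per : forall n, a (S k + n)%nat = a n).
    { intros n. rewrite (Nat.div_mod n (S k)) by lia.
      set (q := (n / S k)%nat). set (r := (n mod S k)%nat).
      assert (Hr : (r < S k)%nat) by (apply Nat.mod_upper_bound; lia).
      destruct (F q) as [F1 F2]. destruct (F (S q)) as [F3 F4].
      replace (S k + (S k * q + r))%nat with (p (S q) + r)%nat by (rewrite F3; lia).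
      replace (S k * q + r)%nat with (p q + r)%nat by (rewrite F1; lia).
      destruct F2 as [A1 [A2 A3]]. destruct F4 as [B1 [B2 B3]].
      destruct (lt_dec (S r) k) as [L|L]; [now rewrite A1, B1|].
      destruct (Nat.eq_dec r k) as [->|E]; [now rewrite A3, B3|].
      replace r with (k - 1)%nat by lia. now rewrite A2, B2. }
    assert (T1 := expands_one_period (S k) beta a t ltac:(lia) Hb Per Ht).
    destruct C0 as [_ [_ Z]]. rewrite P0 in Z. simpl in Z.
    destruct Ht as [Ho _]. rewrite Ho, Z in T1.
    apply (Rmult_eq_reg_l beta); lra.
Qed.

(** At the first time [k] when the orbit meets 0 or 1, it returns to 1 with the
    periodic continuation [c] of (A) or (B), according to the value [t k]. *)
Lemma words_of_zero j : (1 <= j)%nat -> t j = 0 ->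
  (exists k, (1 <= k)%nat /\ forall c, (forall n, c (k + n)%nat = c n) ->
    (forall m, (m < k)%nat -> c m = a m) ->
    lt_alt u c /\ (exists p, block_coded k c a p) /\ ~ seq_eq a c) \/
  (exists k, (1 <= k)%nat /\ forall c, (forall n, c (k + n)%nat = c n) ->
    (forall m, (S m < k)%nat -> c m = a m) -> c (k - 1)%nat = (a (k - 1)%nat + 1)%Z ->
    lt_alt u c /\ exists p, block_coded k c a p).
Proof.
  intros Hj Hz.
  destruct (exists_least (fun k => (1 <= k)%nat /\ (t k = 0 \/ t k = 1))) as [k [[Hk Hk1] Hmin]].
  { exists j. tauto. }
  assert (Hin : forall m, (0 < m < k)%nat -> 0 < t m < 1).
  { intros m Hm. assert (N := Hmin m ltac:(lia)). destruct Ht as [_ [_ Hr]]. specialize (Hr m).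
    destruct (Req_dec (t m) 0) as [E|E]; [destruct N; split; [lia|tauto]|].
    destruct (Req_dec (t m) 1) as [E'|E']; [destruct N; split; [lia|tauto]|]. lra. }
  assert (Hlast : t k = IZR (a (k - 1)%nat) + 1 - beta * t (k - 1)%nat).
  { destruct Ht as [Ho _]. rewrite <- Ho. f_equal. lia. }
  destruct Hk1 as [K0|K1]; [right|left]; exists k; (split; [exact Hk|]).
  - intros c Hc Hca Hl.
    assert (E : IZR (c (k - 1)%nat) - beta * t (k - 1)%nat = 0) by (rewrite Hl, plus_IZR; lra).
    split.
    + apply (expands_one_gt_u beta c _ Hb (periodic_expands k beta a c t Hk Ht Hc Hca E)).
    + now apply (expands_block_coded k beta a c t).
  - intros c Hc Hca.
    assert (Hca' : forall m, (S m < k)%nat -> c m = a m) by (intros; apply Hca; lia).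
    assert (E : IZR (c (k - 1)%nat) - beta * t (k - 1)%nat = 0) by (rewrite Hca by lia; lra).
    assert (HT := periodic_expands k beta a c t Hk Ht Hc Hca' E).
    split; [exact (expands_one_gt_u beta c _ Hb HT)|]. split.
    + now apply (expands_block_coded k beta a c t).
    + intros Eq. destruct HT as [To [T0 _]]. destruct Ht as [Ho [H0 _]].
      assert (To' : orbit beta a (fun n => t (n mod k)%nat)) by (intros n; rewrite Eq; apply To).
      assert (D := orbit_determined beta a _ _ Ho To' (eq_trans H0 (eq_sym T0)) j).
      cbv beta in D. rewrite Hz in D.
      assert (B := Nat.mod_upper_bound j k ltac:(lia)).
      destruct (Nat.eq_dec (j mod k) 0) as [Z|Z]; [rewrite Z, H0 in D; lra|].
      specialize (Hin (j mod k)%nat ltac:(lia)). lra.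
Qed.

End Zeros.

Theorem corollary1 :
  forall a : nat -> Z,
    (forall n : nat, (0 <= a n)%Z) ->
    (forall k : nat, (2 <= k)%nat -> le_alt (seq_drop (k - 1)%nat a) a) ->
    lt_alt u a ->
    let represents (beta : R) : Prop :=
      1 < beta /\
      - alt_series beta a = 1 /\
      (forall k : nat, (1 <= k)%nat ->
         0 <= - alt_series beta (seq_drop k a) <= 1) in
    (exists! beta : R, represents beta) /\
    (forall beta : R, represents beta ->
      ((forall k : nat, (1 <= k)%nat -> alt_series beta (seq_drop k a) <> 0)
       <->
       ((forall k : nat, (1 <= k)%nat ->
           lt_alt u (periodic (seq_take k a)) ->
           ~ (in_omega (seq_take k a)
                (seq_take (k - 1)%nat a ++ [(a (k - 1)%nat - 1)%Z; 0%Z]) a /\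
              ~ seq_eq a (periodic (seq_take k a)))) /\
        (forall k : nat, (1 <= k)%nat ->
           lt_alt u (periodic (seq_take (k - 1)%nat a ++ [(a (k - 1)%nat + 1)%Z])) ->
           ~ in_omega (seq_take k a ++ [0%Z])
               (seq_take (k - 1)%nat a ++ [(a (k - 1)%nat + 1)%Z]) a)))).
Proof.
  intros a Ha Hk Hu represents.
  assert (Hadm : admissible a).
  { intros [|k]; [apply le_alt_refl|]. replace (S k) with (S (S k) - 1)%nat by lia. apply Hk. lia. }
  assert (Hbound : forall n, (0 <= a n <= a 0%nat)%Z).
  { intros n. split; [apply Ha|]. assert (L := le_alt_head _ _ (Hadm n)).
    unfold seq_drop in L. now rewrite Nat.add_0_r in L. }
  assert (Hrep : forall beta, represents beta ->
    expands_one beta a (fun k => - alt_series beta (seq_drop k a))).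
  { intros beta [Hb [H1 Hr]]. split; [now apply series_orbit with (a 0%nat)|].
    split; [exact H1|]. intros [|k]; [|apply Hr; lia].
    change (seq_drop 0 a) with a. lra. }
  split.
  - destruct (expansion_exists a Ha Hadm Hu) as [beta [t [Hb Ht]]].
    exists beta. split.
    + destruct Ht as [Ho [H0 Hr]]. split; [exact Hb|]. split.
      * rewrite (orbit_series beta a t Hb Ho Hr). lra.
      * intros k _. rewrite (orbit_series beta _ _ Hb (orbit_drop beta a t k Ho)); [|intros; apply Hr].
        rewrite Ropp_involutive. apply Hr.
    + intros beta' H'. apply (expands_one_unique beta beta' a t _ Ha Hb (proj1 H') Ht (Hrep _ H')).
  - intros beta HR. assert (Ht := Hrep _ HR). assert (Hb := proj1 HR).
    set (t := fun k => - alt_series beta (seq_drop k a)) in *.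
    assert (LA : forall k, (1 <= k)%nat ->
      (forall n, periodic (seq_take k a) (k + n)%nat = periodic (seq_take k a) n) /\
      (forall m, (m < k)%nat -> periodic (seq_take k a) m = a m)).
    { intros k Hk1. split.
      - intros n. rewrite <- (length_seq_take k a) at 2. apply periodic_period.
      - intros m Hm. rewrite periodic_nth by (now rewrite length_seq_take). now apply nth_seq_take. }
    assert (LB : forall k, (1 <= k)%nat ->
      let c := periodic (seq_take (k - 1) a ++ [(a (k - 1)%nat + 1)%Z]) in
      (forall n, c (k + n)%nat = c n) /\ (forall m, (S m < k)%nat -> c m = a m) /\
      c (k - 1)%nat = (a (k - 1)%nat + 1)%Z).
    { intros k Hk1 c.
      assert (E : length (seq_take (k - 1) a ++ [(a (k - 1)%nat + 1)%Z]) = k).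
      { rewrite length_app, length_seq_take. simpl. lia. }
      split; [|split].
      - intros n. rewrite <- E at 1. apply periodic_period.
      - intros m Hm. unfold c. rewrite periodic_nth by lia. apply nth_take_app. lia.
      - unfold c. rewrite periodic_nth by lia.
        replace (k - 1)%nat with (k - 1 + 0)%nat at 1 by lia. now rewrite nth_take_app_r. }
    split.
    + intros Hnz.
      assert (Hnz' : forall j, (1 <= j)%nat -> t j <> 0) by (intros j Hj E; apply (Hnz j Hj); unfold t in E; lra).
      split; intros k Hk1 Huc.
      * intros [HB Hne]. destruct (LA k Hk1) as [C1 C2].
        apply (in_omega_words_A k a _ Hk1 C2) in HB. destruct HB as [p HB].
        destruct (zero_of_words_A a beta t Ha Hadm Hb Ht k p _ Hk1 C1 C2 Huc HB Hne) as [j [Hj E]].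
        exact (Hnz' j Hj E).
      * intros HB. destruct (LB k Hk1) as [C1 [C2 C3]].
        apply (in_omega_words_B k a _ Hk1 C2 C3) in HB. destruct HB as [p HB].
        exact (Hnz' k Hk1 (zero_of_words_B a beta t Ha Hadm Hb Ht k p _ Hk1 C1 C2 C3 Huc HB)).
    + intros [HA HB] j Hj E.
      assert (Hz : t j = 0) by (unfold t; lra).
      destruct (words_of_zero a beta t Ha Hb Ht j Hj Hz) as [[k [Hk1 H]]|[k [Hk1 H]]].
      * destruct (LA k Hk1) as [C1 C2]. destruct (H _ C1 C2) as [H1 [H2 H3]].
        apply (HA k Hk1 H1). split; [|exact H3]. now apply (in_omega_words_A k a _ Hk1 C2).
      * destruct (LB k Hk1) as [C1 [C2 C3]]. destruct (H _ C1 C2 C3) as [H1 H2].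
        apply (HB k Hk1 H1). now apply (in_omega_words_B k a _ Hk1 C2 C3).
Qed.
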